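(* Let $p\in\mathbb{G}(r,n)$ be a point. Choose a complete flag $\{0\}=V_0\subset V_1\subset \cdots \subset V_{n+1}=\mathbb{C}^{n+1}$ of linear subspaces of $\mathbb{C}^{n+1}$ with $V_{r+1}$ corresponding to the point $p\in \mathbb{G}(r,n)$. For $m=0,1,\dots,r+1$ define the Schubert varieties $$R_m':=\{[U]\in \mathbb{G}(r,n)\;:\; \dim (U \cap V_{r+1})\geq r+1-m \}.$$ For $1\leq m\leq r+1$ define $$R_m'':=\bigcup_{C} C,$$ where the union is over all rational normal curves $C$ with $p\in C\subset \mathbb{G}(r,n)$ and $\deg(C)\leq m$. Finally let $R_m:=\mathbb{G}(r,n)\cap T^m_p\mathbb{G}(r,n)$, where $T^m_p\mathbb{G}(r,n)\subset\mathbb{P}^N$ is the $m$-osculating space of $\mathbb{G}(r,n)$ at $p$. Then $R_m=R_m'=R_m''$ for any $1\leq m\leq r+1$.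
   Context: $\mathbb{G}(r,n)\subset\mathbb{P}^N$, $N=\binom{n+1}{r+1}-1$, is the Grassmannian of $r$-planes in $\mathbb{P}^n$ (equivalently, of $(r+1)$-dimensional linear subspaces $U\subset\mathbb{C}^{n+1}$) in its Plücker embedding; degrees of curves are with respect to this embedding, and a rational normal curve of degree $d$ in $\mathbb{P}^N$ is a smooth rational curve of degree $d$ spanning a $\mathbb{P}^d$. Osculating space: let $X\subset\mathbb{P}^N$ be a projective variety of dimension $s$ and $p\in X$ a smooth point. Choose a local parametrization $\phi:\mathcal{U}\subset\mathbb{C}^s\to\mathbb{C}^N$, $(t_1,\dots,t_s)\mapsto\phi(t_1,\dots,t_s)$, of $X$ at $p$ with $\phi(0)=p$. For a multi-index $I=(i_1,\dots,i_s)$ set $\phi_I=\frac{\partial^{|I|}\phi}{\partial t_1^{i_1}\cdots\partial t_s^{i_s}}$. For $m\ge 0$ let $O^m_pX$ be the affine subspace of $\mathbb{C}^N$ centered at $p$ and spanned by the vectors $\phi_I(0)$ with $|I|\le m$. The $m$-osculating space $T^m_pX$ is the projective closure of $O^m_pX$ in $\mathbb{P}^N$; thus $T_p^0X=\{p\}$ and $T^1_pX$ is the projective tangent space. *)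

(* Defs.v *)
From HB Require Import structures.
From mathcomp Require Import all_boot all_order all_algebra complex.
From mathcomp Require Import all_classical all_reals all_analysis.

Set Implicit Arguments.
Unset Strict Implicit.
Unset Printing Implicit Defensive.

Import Order.TTheory GRing.Theory Num.Theory.
Import numFieldNormedType.Exports.

Local Open Scope classical_set_scope.
Local Open Scope ring_scope.

(* The complex numbers over [R : realType], packaged with the structure that   *)
(* gives ['rV[Cplx R]_k] its topology and complex differential calculus.       *)
Notation Cplx R := (complex R : numClosedFieldType).

(* Throughout, a point of the projective space P(K^M) is a line of K^M, i.e. a *)
(* subspace [L] with [\dim L = 1], and a subset of P(K^M) is a                 *)
(* [set {vspace 'rV[K]_M}] all of whose members are lines.                     *)

Section Projective.
Variables (K : numClosedFieldType) (M : nat).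

(* [W] is the cone over the projective linear subspace spanned by [X]. *)
Definition linear_span (X : set {vspace 'rV[K]_M}) (W : {vspace 'rV[K]_M}) :=
  (forall L, X L -> (L <= W)%VS) /\
  (forall W' : {vspace 'rV[K]_M},
     (forall L, X L -> (L <= W')%VS) -> (W <= W')%VS).

(* The affine charts of P(K^M) are the complements of hyperplanes [l <> 0],    *)
(* identified with the affine hyperplanes [x *m l = 1] of K^M.                 *)
Definition affine_part (X : set {vspace 'rV[K]_M}) (l : 'cV[K]_M) :
    set 'rV[K]_M :=
  [set x | (x *m l) 0 0 = 1 /\ X <[x]>%VS].

(* Projective closure of an affine subspace [A] of a chart: the closure of     *)
(* such an [A] is the projective linear subspace it spans.                     *)
Definition proj_closure (A : set 'rV[K]_M) : set {vspace 'rV[K]_M} :=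
  [set L | \dim L = 1%N /\
     forall W : {vspace 'rV[K]_M}, (forall a, A a -> a \in W) -> (L <= W)%VS].

End Projective.

Section Osculating.
Variables (K : numClosedFieldType) (s M : nat).
Implicit Types (phi : 'rV[K]_s -> 'rV[K]_M) (l : 'cV[K]_M).

Definition partial (i : 'I_s) phi : 'rV[K]_s -> 'rV[K]_M :=
  fun t => 'D_(delta_mx 0 i) phi t.

(* [phi_I] for the multi-index [I]. *)
Definition mpartial (I : 'I_s -> nat) phi : 'rV[K]_s -> 'rV[K]_M :=
  foldr (fun i => iter (I i) (partial i)) phi (enum 'I_s).

(* Holomorphy is expressed as complex differentiability of all the iterated    *)
(* partial derivatives. Only the values of [phi] on [U] matter.                *)
Record local_parametrization (X : set {vspace 'rV[K]_M})
    (p : {vspace 'rV[K]_M}) l (U : set 'rV[K]_s) phi : Prop := {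
  lp_open : open U;
  lp_0 : U 0;
  lp_p : <[phi 0%R]>%VS = p;
  lp_holo : forall (w : seq 'I_s) t, U t ->
    differentiable (foldr partial phi w) t;
  lp_inj : set_inj U phi;
  lp_immersion : forall t, U t -> injective ('d phi t);
  lp_image : exists2 W : set 'rV[K]_M, open W &
    phi @` U = affine_part X l `&` W }.

(* The vector [phi 0] itself ([|I| = 0]) is the centre, not a direction: the   *)
(* origin of the chart is implicitly at [p], and [O^0_p X] is [{p}].           *)
Definition osculating_directions phi (m : nat) : {vspace 'rV[K]_M} :=
  (\sum_(I : {ffun 'I_s -> 'I_m.+1} | (0 < \sum_i I i <= m)%N)
     <[mpartial (fun i => I i) phi 0%R]>)%VS.

Definition affine_osculating phi (m : nat) : set 'rV[K]_M :=
  [set x | x - phi 0 \in osculating_directions phi m].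

Definition osculating_space phi (m : nat) : set {vspace 'rV[K]_M} :=
  proj_closure (affine_osculating phi m).

End Osculating.

Section Curves.
Variables (K : numClosedFieldType) (M : nat).
Implicit Types (e : nat) (C : set {vspace 'rV[K]_M}).

(* [A] collects the coefficients of [M] binary forms of degree [e]:            *)
(* row [k] of [A] is the coefficient of [x ^+ (e - k) * y ^+ k].               *)
Definition forms e (A : 'M[K]_(e.+1, M)) (x y : K) : 'rV[K]_M :=
  \sum_(k < e.+1) (x ^+ (e - k) * y ^+ k) *: row k A.

Definition forms_dx e (A : 'M[K]_(e.+1, M)) (x y : K) : 'rV[K]_M :=
  \sum_(k < e.+1) ((e - k)%:R * x ^+ (e - k).-1 * y ^+ k) *: row k A.

Definition forms_dy e (A : 'M[K]_(e.+1, M)) (x y : K) : 'rV[K]_M :=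
  \sum_(k < e.+1) (k%:R * x ^+ (e - k) * y ^+ k.-1) *: row k A.

(* [A] defines a closed embedding of P^1: the forms have no common zero, and   *)
(* the resulting morphism is injective on points and on tangent vectors (the   *)
(* latter meaning that the differential of the map of cones has rank 2).       *)
Record P1_embedding e (A : 'M[K]_(e.+1, M)) : Prop := {
  P1_base_point_free : forall x y, (x, y) != (0, 0) -> forms A x y != 0;
  P1_inj : forall x y x' y', (x, y) != (0, 0) -> (x', y') != (0, 0) ->
    <[forms A x y]>%VS = <[forms A x' y']>%VS -> x * y' = x' * y;
  P1_immersion : forall x y, (x, y) != (0, 0) ->
    free [:: forms_dx A x y; forms_dy A x y] }.

Definition P1_image e (A : 'M[K]_(e.+1, M)) : set {vspace 'rV[K]_M} :=
  [set L | exists x y, (x, y) != (0, 0) /\ L = <[forms A x y]>%VS].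

Definition smooth_rational_curve C : Prop :=
  exists e (A : 'M[K]_(e.+1, M)), P1_embedding A /\ C = P1_image A.

Definition hyperplane_section C (H : {vspace 'rV[K]_M}) :
    set {vspace 'rV[K]_M} :=
  [set L | C L /\ (L <= H)%VS].

(* The degree of an irreducible curve: the maximal number of points in a       *)
(* hyperplane section by a hyperplane not containing the curve, attained by    *)
(* the general hyperplane.                                                     *)
Definition curve_degree C (d : nat) : Prop :=
  (exists H : {vspace 'rV[K]_M},
     [/\ (\dim H).+1 = M, ~ (forall L, C L -> (L <= H)%VS) &
         (hyperplane_section C H #= `I_d)%card]) /\
  (forall H : {vspace 'rV[K]_M},
     (\dim H).+1 = M -> ~ (forall L, C L -> (L <= H)%VS) ->
     exists2 k, (k <= d)%N & (hyperplane_section C H #= `I_k)%card).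

Definition rational_normal_curve C (d : nat) : Prop :=
  [/\ smooth_rational_curve C, curve_degree C d &
      exists2 W : {vspace 'rV[K]_M}, linear_span C W & \dim W = d.+1].

End Curves.

Section Grassmannian.
Variables (K : numClosedFieldType) (n r : nat).
Local Notation PN := {vspace 'rV[K]_('C(n.+1, r.+1))}.

(* Pluecker coordinates are indexed by an enumeration of the (r+1)-subsets [J] *)
(* of ['I_n.+1]; [enum J] lists [J] increasingly.                              *)
Definition plucker_index (k : 'I_('C(n.+1, r.+1))) : {set 'I_n.+1} :=
  nth finset.set0 (enum [set J : {set 'I_n.+1} | #|J| == r.+1]%SET) k.

Definition plucker_vector (A : 'M[K]_(r.+1, n.+1)) : 'rV[K]_('C(n.+1, r.+1)) :=
  \row_k \det (colsub (fun j : 'I_r.+1 => nth ord0 (enum (plucker_index k)) j) A).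

(* Meaningful for [\dim U = r.+1]; the line does not depend on the basis. *)
Definition plucker (U : {vspace 'rV[K]_n.+1}) : PN :=
  <[plucker_vector (\matrix_(i < r.+1) (vbasis U)`_i)]>%VS.

Definition grassmannian : set PN :=
  plucker @` [set U : {vspace 'rV[K]_n.+1} | \dim U = r.+1].

Definition complete_flag (V : nat -> {vspace 'rV[K]_n.+1}) : Prop :=
  (forall i, (i <= n.+1)%N -> \dim (V i) = i) /\
  (forall i, (i <= n)%N -> (V i <= V i.+1)%VS).

Definition R_osc (s : nat) (phi : 'rV[K]_s -> 'rV[K]_('C(n.+1, r.+1)))
    (m : nat) : set PN :=
  grassmannian `&` osculating_space phi m.

Definition R_schubert (V : nat -> {vspace 'rV[K]_n.+1}) (m : nat) : set PN :=
  plucker @` [set U : {vspace 'rV[K]_n.+1} |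
    \dim U = r.+1 /\ (r.+1 - m <= \dim (U :&: V r.+1)%VS)%N].

Definition R_curves (p : PN) (m : nat) : set PN :=
  \bigcup_(C in [set C : set PN |
    [/\ exists2 d, (d <= m)%N & rational_normal_curve C d,
        C p & C `<=` grassmannian]]) C.

End Grassmannian.

Arguments grassmannian K n r : clear implicits.
Arguments plucker {K n} r U.
Arguments R_schubert {K n} r V m.

(* Main.v *)
Require Import Defs.
From mathcomp Require Import all_boot all_order all_algebra all_fingroup all_field complex.
From mathcomp Require Import all_classical all_reals all_analysis.
From mathcomp Require Import zify ring.

(** The three sets are compared through a basis adapted to two subspaces. Let [V]
    be the subspace of the point [p], let [W] be another point of the Grassmannian,
    and let [k] be the codimension of the intersection in either of them. There is a
    basis of the ambient space, with first [r.+1] vectors the rows of [E] and the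
    others the rows of [C], such that [V] is the span of [E] and [W] is the span of
    the first [k] rows of [C] and the last [r.+1 - k] rows of [E]
    ([adapted_frame]). The Schubert condition says [k <= m], and the theorem is that
    the two other conditions on [W] say the same.

    Near [p] the Grassmannian is the graph of a map with polynomial entries: a
    subspace is the row space of [E + X *m C], and its Pluecker vector expands into
    homogeneous terms in [X] ([minors_chart], [minors_pencil]). There is a linear
    form on Pluecker vectors, a coordinate in the dual basis, which does not vanish
    at [W] and which in the chart is a [k]-minor of [X] ([arc_mixed_dual]). It
    therefore vanishes to order [k] along every arc that starts at [p].

    If [m < k], this form kills the partial derivatives of order at most [m] of a
    parametrization at [p], that is, the osculating space, but it does not kill [W].
    Likewise, along a curve on the Grassmannian parametrized by forms of degree
    [e < k] it would be a polynomial of degree at most [e] vanishing to order [k],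
    so [W] is not on a curve through [p] of that kind. Here [e] is at most the degree
    of the curve, because a general hyperplane section of it has [e] points
    ([transverse_form], [curve_degree_ge]).

    If [k <= m], let [h] be a form which kills the partial derivatives of order at
    most [m] of [phi]. Since [phi] is an immersion, its differential is onto in the
    chart, so Taylor expansion of [phi] along lines reaches all directions, and the
    homogeneous terms of [h] in the chart have to vanish one after the other up to
    degree [m] ([arc_lowest_term], [osculating_mixed]). The term of degree [k] at
    [X := pid_mx k] is the value of [h] at [W], so [W] is in the osculating space.
    A rational normal curve of degree [k] from [p] to [W] is obtained by moving the
    first [k] rows of [E] linearly to those of [C] ([mixed_curveK],
    [rational_normal_forms]); for [k = 0] one takes any line through [p]. *)

Set Implicit Arguments.
Unset Strict Implicit.
Unset Printing Implicit Defensive.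

Import Order.TTheory GRing.Theory Num.Theory.
Import numFieldNormedType.Exports.

Local Open Scope classical_set_scope.
Local Open Scope ring_scope.

(** * Minors and the Cauchy-Binet formula *)

Section PluckerIndex.
Variables (n r : nat).
Local Notation index := (@plucker_index n r).

Lemma card_plucker_index k : #|index k| = r.+1.
Proof.
have: index k \in [set J : {set 'I_n.+1} | #|J| == r.+1]%SET.
  by rewrite -mem_enum mem_nth // -cardE card_draws card_ord.
by rewrite inE => /eqP.
Qed.

Lemma plucker_index_inj : injective index.
Proof.
move=> k1 k2 /eqP; rewrite nth_uniq ?enum_uniq //; first by move/eqP/val_inj.
- by rewrite -cardE card_draws card_ord.
- by rewrite -cardE card_draws card_ord.
Qed.

Lemma plucker_index_surj (J : {set 'I_n.+1}) :
  #|J| = r.+1 -> exists k, index k = J.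
Proof.
move=> cJ.
have inJ : J \in enum [set J : {set 'I_n.+1} | #|J| == r.+1]%SET.
  by rewrite mem_enum inE cJ.
have lt_k : (seq.index J (enum [set J : {set 'I_n.+1} | #|J| == r.+1]%SET)
    < 'C(n.+1, r.+1))%N.
  by rewrite -[X in 'C(X, _)](card_ord n.+1) -card_draws cardE index_mem.
by exists (Ordinal lt_k); rewrite /plucker_index nth_index.
Qed.

Definition selection k (j : 'I_r.+1) : 'I_n.+1 := nth ord0 (enum (index k)) j.

Lemma size_enum_plucker_index k : size (enum (index k)) = r.+1.
Proof. by rewrite -cardE card_plucker_index. Qed.

Lemma selection_inj k : injective (selection k).
Proof.
move=> i j /eqP; rewrite nth_uniq ?enum_uniq ?size_enum_plucker_index //.
by move/eqP/val_inj.
Qed.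

Lemma selection_image k : (selection k @: [set: 'I_r.+1])%SET = index k.
Proof.
apply/eqP; rewrite eqEcard card_plucker_index card_imset ?cardsT ?card_ord //;
  last exact: selection_inj.
rewrite leqnn andbT; apply/fintype.subsetP => _ /imsetP [i _ ->].
by rewrite -mem_enum mem_nth // size_enum_plucker_index.
Qed.

(** Together with [selection_perm_inj], this reindexes sums over injections by
    pairs of a Pluecker index and a permutation. *)
Lemma injection_selection (f : {ffun 'I_r.+1 -> 'I_n.+1}) :
  injective f -> exists k (s : 'S_r.+1), f = [ffun i => selection k (s i)].
Proof.
move=> f_inj.
have [|k kE] := @plucker_index_surj (f @: [set: 'I_r.+1])%SET.
  by rewrite card_imset // cardsT card_ord.
have f_sel i : exists j, selection k j == f i.
  have : f i \in (selection k @: [set: 'I_r.+1])%SET.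
    by rewrite selection_image kE imset_f.
  by case/imsetP => j _ ->; exists j.
pose s i := xchoose (f_sel i).
have sE i : selection k (s i) = f i by apply/eqP/(xchooseP (f_sel i)).
have s_inj : injective s by move=> i j /(congr1 (selection k)); rewrite !sE => /f_inj.
by exists k, (perm s_inj); apply/ffunP => i; rewrite ffunE permE sE.
Qed.

Lemma selection_perm_inj :
  injective (fun x : 'I_('C(n.+1, r.+1)) * 'S_r.+1 =>
               [ffun i => selection x.1 (x.2 i)]).
Proof.
move=> [k s] [k' s'] /ffunP /= eq_ks.
have eqk : k = k'.
  apply: plucker_index_inj; rewrite -!selection_image.
  have im (j : 'I_('C(n.+1, r.+1))) (t : 'S_r.+1) : (selection j @: [set: 'I_r.+1] =
      [set selection j (t i) | i : 'I_r.+1])%SET.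
    apply/setP => y; apply/imsetP/imsetP => [] [i _ ->].
      by exists (t^-1%g i); rewrite // permKV.
    by exists (t i).
  rewrite (im k s) (im k' s'); apply: eq_imset => i.
  by have := eq_ks i; rewrite !ffunE.
rewrite -{k'}eqk in eq_ks *; congr pair; apply/permP => i.
by have := eq_ks i; rewrite !ffunE => /selection_inj.
Qed.

End PluckerIndex.

Section Minors.
Variables (n r : nat).

(** The Pluecker vector makes sense over any commutative ring; it is needed
    over polynomial rings, where arcs on the Grassmannian live. *)
Definition minors (R : comNzRingType) (A : 'M[R]_(r.+1, n.+1)) :
    'rV[R]_('C(n.+1, r.+1)) :=
  \row_k \det (colsub (@selection n r k) A).

Lemma map_minors (R S : comNzRingType) (f : {rmorphism R -> S})
    (A : 'M[R]_(r.+1, n.+1)) : map_mx f (minors A) = minors (map_mx f A).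
Proof.
apply/rowP => k; rewrite !mxE -det_map_mx; congr (\det _).
by apply/matrixP => i j; rewrite !mxE.
Qed.

Lemma minors_mulmx (R : comNzRingType) (M : 'M[R]_r.+1) (A : 'M[R]_(r.+1, n.+1)) :
  minors (M *m A) = \det M *: minors A.
Proof.
apply/rowP => k; rewrite !mxE -det_mulmx; congr (\det _).
by apply/matrixP => i j; rewrite !mxE; apply: eq_bigr => l _; rewrite !mxE.
Qed.

(** By [minors_coform] below, this column represents the linear form on Pluecker
    vectors that takes [minors A] to [\det (A *m B)]. *)
Definition coform (R : comNzRingType) (B : 'M[R]_(n.+1, r.+1)) :
  'cV[R]_('C(n.+1, r.+1)) := (minors B^T)^T.

Lemma map_coform (R S : comNzRingType) (f : {rmorphism R -> S})
    (B : 'M[R]_(n.+1, r.+1)) : map_mx f (coform B) = coform (map_mx f B).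
Proof. by rewrite /coform -map_trmx map_minors map_trmx. Qed.

(** The Cauchy-Binet formula. As in the proof of the multiplicativity of the
    determinant, the product is expanded along all maps [f] from rows of [A] to
    rows of [B]; only injections survive, and each of them is a selection
    followed by a permutation. *)
Lemma minors_coform (R : comNzRingType) (A : 'M[R]_(r.+1, n.+1))
    (B : 'M[R]_(n.+1, r.+1)) :
  (minors A *m coform B) 0 0 = \det (A *m B).
Proof.
pose AB (s : 'S_r.+1) i j := A i j * B j (s i).
have -> : \det (A *m B) =
    \sum_(f : {ffun 'I_r.+1 -> 'I_n.+1})
       \det (\matrix_(i, j) B (f i) j) * \prod_i A i (f i).
  transitivity (\sum_(f : {ffun 'I_r.+1 -> 'I_n.+1})
      \sum_(s : 'S_r.+1) (-1) ^+ s * \prod_i AB s i (f i)).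
    rewrite exchange_big; apply: eq_bigr => /= s _; rewrite -big_distrr /=.
    congr (_ * _); rewrite -(bigA_distr_bigA (AB s)) /=.
    by apply: eq_bigr => x _; rewrite mxE.
  apply: eq_bigr => f _; rewrite mulrC big_distrr /=; apply: eq_bigr => s _.
  rewrite mulrCA big_split //=; congr (_ * (_ * _)).
  by apply: eq_bigr => x _; rewrite mxE.
rewrite (bigID (fun f => f \in [set [ffun i => selection x.1 (x.2 i)] |
  x : 'I_('C(n.+1, r.+1)) * 'S_r.+1]%SET)) /= [X in _ + X]big1 ?addr0; last first.
  move=> f; case: (boolP (injectiveb f)) => [/injectiveP f_inj|].
    have [k [s ->]] := injection_selection f_inj.
    by move=> /imsetP []; exists (k, s).
  case/injectivePn => i1 [i2 Di12 Ef12] _.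
  by rewrite (determinant_alternate Di12) ?mul0r //= => j; rewrite !mxE Ef12.
rewrite big_imset /=; last by move=> x y _ _; exact: selection_perm_inj.
rewrite (eq_bigl xpredT) => [|x]; last by rewrite inE.
rewrite -(pair_bigA _ (fun k (s : 'S_r.+1) =>
  \det (\matrix_(i, j) B ([ffun i0 => selection k (s i0)] i) j) *
  \prod_i A i ([ffun i0 => selection k (s i0)] i))) /=.
rewrite mxE; apply: eq_bigr => k _; rewrite mxE.
rewrite {1}/determinant big_distrl /=; apply: eq_bigr => s _.
rewrite (_ : \matrix_(i, j) _ = row_perm s (colsub (selection k) B^T)^T); last first.
  by apply/matrixP => i j; rewrite !mxE ffunE.
rewrite row_permE det_mulmx det_perm det_tr !mxE mulrAC; congr (_ * _ * _).
by apply: eq_bigr => i _; rewrite ffunE !mxE.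
Qed.

End Minors.

(** * Expansion of the minors of a pencil of matrices *)

Section MixedMinors.
Variables (n r : nat).

Definition mixrows (R : comNzRingType) (S : {set 'I_r.+1})
    (E F : 'M[R]_(r.+1, n.+1)) : 'M[R]_(r.+1, n.+1) :=
  \matrix_(i, j) (if i \in S then F i j else E i j).

Definition mixminors (R : comNzRingType) (k : nat)
    (E F : 'M[R]_(r.+1, n.+1)) : 'rV[R]_('C(n.+1, r.+1)) :=
  \sum_(S : {set 'I_r.+1} | #|S| == k) minors (mixrows S E F).

Lemma map_mixminors (R S : comNzRingType) (f : {rmorphism R -> S}) k
    (E F : 'M[R]_(r.+1, n.+1)) :
  map_mx f (mixminors k E F) = mixminors k (map_mx f E) (map_mx f F).
Proof.
rewrite /mixminors raddf_sum; apply: eq_bigr => T _; rewrite /= map_minors; congr minors.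
by apply/matrixP => i j; rewrite !mxE; case: ifP.
Qed.

Lemma minors_scale_rows (R : comNzRingType) (d : 'I_r.+1 -> R)
    (A : 'M[R]_(r.+1, n.+1)) :
  minors (\matrix_(i, j) (d i * A i j)) = (\prod_i d i) *: minors A.
Proof.
rewrite (_ : \matrix_(i, j) _ = diag_mx (\row_i d i) *m A); last first.
  by apply/matrixP => i j; rewrite mul_diag_mx !mxE.
rewrite minors_mulmx det_diag; congr (_ *: _).
by apply: eq_bigr => i _; rewrite mxE.
Qed.

Lemma prod_card_const (R : comNzRingType) (S : {set 'I_r.+1}) (x y : R) :
  \prod_i (if i \in S then y else x) = x ^+ (r.+1 - #|S|) * y ^+ #|S|.
Proof.
rewrite (bigID (fun i => i \in S)) /= mulrC; congr (_ * _).
  rewrite (eq_bigr (fun=> x)) => [|i /negbTE -> //].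
  rewrite prodr_const; congr (_ ^+ _).
  have -> : (r.+1 - #|S| = #|~: S|)%N by rewrite [RHS]cardsCs finset.setCK card_ord.
  by apply: eq_card => i; rewrite !inE.
rewrite (eq_bigr (fun=> y)) => [|i -> //].
by rewrite prodr_const.
Qed.

(** Multilinearity of the minors in the rows: [mixminors k E F] is the
    coefficient of [x ^+ (r.+1 - k) * y ^+ k]. *)
Lemma minors_pencil (R : comNzRingType) (x y : R) (E F : 'M[R]_(r.+1, n.+1)) :
  minors (x *: E + y *: F) =
    \sum_(k < r.+2) (x ^+ (r.+1 - k) * y ^+ k) *: mixminors k E F.
Proof.
transitivity (\sum_(S : {set 'I_r.+1})
    (x ^+ (r.+1 - #|S|) * y ^+ #|S|) *: minors (mixrows S E F)).
  apply/rowP => k; rewrite summxE mxE /determinant.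
  under [RHS]eq_bigr do rewrite !mxE /determinant big_distrr /=.
  rewrite exchange_big /=; apply: eq_bigr => s _.
  under [X in _ * X = _]eq_bigr do rewrite !mxE addrC.
  rewrite bigA_distr big_distrr /=; apply: eq_bigr => S _.
  rewrite mulrCA; congr (_ * _).
  rewrite -prod_card_const -big_split /=; apply: eq_bigr => i _.
  by rewrite !mxE; case: ifP.
rewrite (partition_big (fun S : {set 'I_r.+1} => inord #|S| : 'I_r.+2) xpredT) //=.
have cardS (S : {set 'I_r.+1}) : (#|S| < r.+2)%N.
  by rewrite ltnS -[X in (_ <= X)%N](card_ord r.+1) max_card.
apply: eq_bigr => k _; rewrite scaler_sumr; apply: eq_big => [S|S /eqP Sk].
  by rewrite -val_eqE /= inordK.
by rewrite -{1 2}Sk inordK.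
Qed.

Lemma mixminors0 (R : comNzRingType) (E F : 'M[R]_(r.+1, n.+1)) :
  mixminors 0 E F = minors E.
Proof.
rewrite /mixminors (big_pred1 finset.set0) => [|S]; last by rewrite cards_eq0.
by congr minors; apply/matrixP => i j; rewrite mxE inE.
Qed.

Lemma minors_row0 (R : comNzRingType) (i : 'I_r.+1) (A : 'M[R]_(r.+1, n.+1)) :
  (forall j, A i j = 0) -> minors A = 0.
Proof.
move=> Ai0; rewrite [LHS](_ : _ = minors (\matrix_(a, b)
    ((if a == i then 0 else 1) * A a b))).
  by rewrite minors_scale_rows (bigD1 i) //= eqxx mul0r scale0r.
congr minors; apply/matrixP => a b; rewrite !mxE.
by have [->|] := eqVneq a i; rewrite ?Ai0 ?mul0r ?mul1r.
Qed.

Let initial k : {set 'I_r.+1} := [set i : 'I_r.+1 | (i < k)%N]%SET.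

Let minors_mixrows0 (R : comNzRingType) k (S : {set 'I_r.+1})
    (E F : 'M[R]_(r.+1, n.+1)) :
  (forall (i : 'I_r.+1) j, (k <= i)%N -> F i j = 0) -> ~~ (S \subset initial k) ->
  minors (mixrows S E F) = 0.
Proof.
move=> F0 /subsetPn [i iS]; rewrite inE -leqNgt => ki.
by apply: (@minors_row0 _ i) => j; rewrite mxE iS F0.
Qed.

Let card_initial k : (k <= r.+1)%N -> #|initial k| = k.
Proof.
move=> kr; rewrite -[RHS](card_ord k) -(@card_imset _ _ (widen_ord kr)); last first.
  by move=> i j /(congr1 val) /= /val_inj.
apply: eq_card => i; rewrite inE; apply/idP/imsetP => [ik|[j _ ->]]; last first.
  exact: (ltn_ord j).
by exists (Ordinal ik) => //; apply: val_inj.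
Qed.

(** When only the first [k] rows of [F] are nonzero, the mixed minors stop in
    degree [k], where they consist of a single term. *)
Lemma mixminors_gt (R : comNzRingType) k l (E F : 'M[R]_(r.+1, n.+1)) :
  (k <= r.+1)%N -> (forall (i : 'I_r.+1) j, (k <= i)%N -> F i j = 0) -> (k < l)%N ->
  mixminors l E F = 0.
Proof.
move=> kr F0 kl; rewrite /mixminors big1 // => S /eqP cS.
apply: minors_mixrows0 F0 _; apply: contraL kl => /subset_leq_card.
by rewrite cS card_initial // -leqNgt.
Qed.

Lemma mixminors_eq (R : comNzRingType) k (E F : 'M[R]_(r.+1, n.+1)) :
  (k <= r.+1)%N -> (forall (i : 'I_r.+1) j, (k <= i)%N -> F i j = 0) ->
  mixminors k E F = minors (\matrix_(i, j) (if (i < k)%N then F i j else E i j)).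
Proof.
move=> kr F0; rewrite /mixminors (bigD1 (initial k)) ?card_initial //=.
rewrite [X in _ + X]big1 ?addr0.
  by congr minors; apply/matrixP => i j; rewrite !mxE inE.
move=> S /andP [/eqP cS S_neq]; apply: minors_mixrows0 F0 _.
by apply: contraNN S_neq => Sk; rewrite eqEcard Sk card_initial // cS leqnn.
Qed.

End MixedMinors.

(** * Frames and affine charts of the Grassmannian *)

Section Frames.
Variables (n r : nat).
Local Notation q := r.+1.
Local Notation c := (n - r)%N.
Local Notation N := ('C(n.+1, r.+1)).

(** The rows of [E] and [C] form a basis of the ambient space, and the columns of
    [B] and [D] form the dual basis. Keeping the four blocks apart avoids casts
    along [r.+1 + (n - r) = n.+1]. *)
Record frame (R : comNzRingType) (E : 'M[R]_(q, n.+1)) (C : 'M[R]_(c, n.+1))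
    (B : 'M[R]_(n.+1, q)) (D : 'M[R]_(n.+1, c)) : Prop := {
  frame_EB : E *m B = 1%:M;
  frame_ED : E *m D = 0;
  frame_CB : C *m B = 0;
  frame_CD : C *m D = 1%:M;
  frame_id : B *m E + D *m C = 1%:M }.

Lemma map_frame (R S : comNzRingType) (f : {rmorphism R -> S}) E C B D :
  @frame R E C B D ->
  @frame S (map_mx f E) (map_mx f C) (map_mx f B) (map_mx f D).
Proof.
case=> EB ED CB CD id; split; rewrite -!map_mxM ?EB ?ED ?CB ?CD ?map_mx1 ?map_mx0 //.
by rewrite -map_mxD id map_mx1.
Qed.

Definition replace_col (R : comNzRingType) (B : 'M[R]_(n.+1, q))
    (D : 'M[R]_(n.+1, c)) i j : 'M[R]_(n.+1, q) :=
  \matrix_(a, b) (if b == i then D a j else B a b).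

(** For [w = minors A], [chart0 B w] is the determinant of [A *m B] and
    [chartY B D w] is [\adj (A *m B) *m A *m D]: up to the common factor
    [chart0 B w], these are the coordinates of the row space of [A] as the graph
    of a linear map from the span of [E] to the span of [C]. *)
Definition chart0 (R : comNzRingType) (B : 'M[R]_(n.+1, q)) (w : 'rV[R]_N) : R :=
  (w *m coform B) 0 0.

Definition chartY (R : comNzRingType) (B : 'M[R]_(n.+1, q)) (D : 'M[R]_(n.+1, c))
    (w : 'rV[R]_N) : 'M[R]_(q, c) :=
  \matrix_(i, j) (w *m coform (replace_col B D i j)) 0 0.

Lemma chart0Z (R : comNzRingType) B a w : @chart0 R B (a *: w) = a * chart0 B w.
Proof. by rewrite /chart0 -scalemxAl mxE. Qed.

Lemma chartYZ (R : comNzRingType) B D a w :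
  @chartY R B D (a *: w) = a *: chartY B D w.
Proof.
by apply/matrixP => i j; rewrite [LHS]mxE -scalemxAl [LHS]mxE [RHS]mxE [in RHS]mxE.
Qed.

Lemma map_chart0 (R S : comNzRingType) (f : {rmorphism R -> S}) B w :
  chart0 (map_mx f B) (map_mx f w) = f (@chart0 R B w).
Proof. by rewrite /chart0 -map_coform -map_mxM mxE. Qed.

Lemma map_chartY (R S : comNzRingType) (f : {rmorphism R -> S}) B D w :
  chartY (map_mx f B) (map_mx f D) (map_mx f w) = map_mx f (@chartY R B D w).
Proof.
apply/matrixP => i j; rewrite [LHS]mxE [RHS]mxE [in RHS]mxE.
have -> : replace_col (map_mx f B) (map_mx f D) i j = map_mx f (replace_col B D i j).
  by apply/matrixP => a b; rewrite !mxE; case: ifP.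
by rewrite -map_coform -map_mxM mxE.
Qed.

Lemma chartY_minors (R : comNzRingType) A B D :
  @chartY R B D (minors A) = \adj (A *m B) *m (A *m D).
Proof.
apply/matrixP => i j; rewrite [LHS]mxE [RHS]mxE minors_coform.
rewrite (expand_det_col _ i); apply: eq_bigr => k _; rewrite mulrC; congr (_ * _).
  rewrite [RHS]mxE /cofactor; congr (_ * \det _).
  apply/matrixP => a b; rewrite !mxE; apply: eq_bigr => l _; rewrite !mxE.
  by rewrite eq_sym (negbTE (neq_lift _ _)).
by rewrite !mxE; apply: eq_bigr => l _; rewrite !mxE eqxx.
Qed.

(** The Grassmannian near the span of [E] is the graph of a polynomial map, here
    in a form free of denominators: with [S := A *m B],
    [\det S *: E + chartY *m C = \adj S *m (S *m E + A *m D *m C) = \adj S *m A].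
    All the geometry of the proof goes through this identity. *)
Lemma minors_chart (R : comNzRingType) E C B D (F : @frame R E C B D)
    (A : 'M[R]_(q, n.+1)) (k : R) (w := k *: minors A) :
  chart0 B w ^+ q *: w =
    chart0 B w *: minors (chart0 B w *: E + chartY B D w *m C).
Proof.
rewrite /w chart0Z chartYZ chartY_minors /chart0 minors_coform.
set S := A *m B; set a := k * \det S.
have -> : a *: E + (k *: (\adj S *m (A *m D))) *m C = (k *: \adj S) *m A.
  have -> : a *: E = k *: (\adj S *m (S *m E)).
    by rewrite mulmxA mul_adj_mx mul_scalar_mx scalerA.
  rewrite -!scalemxAl -scalerDr; congr (_ *: _).
  rewrite -[_ *m C]mulmxA -mulmxDr; congr (_ *m _).
  by rewrite /S -!mulmxA -mulmxDr (frame_id F) mulmx1.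
rewrite minors_mulmx detZ !scalerA; congr (_ *: _).
have detS : \det S ^+ q = \det (\adj S) * \det S.
  by rewrite -det_mulmx mul_adj_mx det_scalar.
by rewrite {1}/a exprMn detS /a; ring.
Qed.

Lemma chart0_frame (R : comNzRingType) E C B D (F : @frame R E C B D) :
  chart0 B (minors E) = 1.
Proof. by rewrite /chart0 minors_coform (frame_EB F) det1. Qed.

Lemma chartY_frame (R : comNzRingType) E C B D (F : @frame R E C B D) :
  chartY B D (minors E) = 0.
Proof. by rewrite chartY_minors (frame_ED F) mulmx0. Qed.

(** The rows of [mixed_basis k E C] are the first [k] rows of [C] followed by the
    last [q - k] rows of [E]: such a subspace is at distance [k] from the span of
    [E], and in a suitable frame every subspace has this form. *)
Definition mixed_basis (R : comNzRingType) k (E : 'M[R]_(q, n.+1))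
    (C : 'M[R]_(c, n.+1)) : 'M[R]_(q, n.+1) :=
  copid_mx k *m E + pid_mx k *m C.

Definition mixed_dual (R : comNzRingType) k (B : 'M[R]_(n.+1, q))
    (D : 'M[R]_(n.+1, c)) : 'M[R]_(n.+1, q) :=
  B *m copid_mx k + D *m pid_mx k.

Lemma row_mixed_lt (R : comNzRingType) k E C (i : 'I_q) (i' : 'I_c) :
  (i < k)%N -> i = i' :> nat -> row i (@mixed_basis R k E C) = row i' C.
Proof.
move=> ik ii'; rewrite raddfD /= !row_mul.
have -> : row i (copid_mx k : 'M[R]_q) = 0.
  by apply/rowP => j; rewrite !mxE ik andbT subrr.
have -> : row i (pid_mx k) = delta_mx 0 i' :> 'rV[R]_c.
  by apply/rowP => j; rewrite !mxE ik andbT eqxx ii' [in RHS]eq_sym.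
by rewrite mul0mx add0r -rowE.
Qed.

Lemma row_mixed_ge (R : comNzRingType) k E C (i : 'I_q) :
  (k <= i)%N -> row i (@mixed_basis R k E C) = row i E.
Proof.
move=> ki; rewrite raddfD /= !row_mul.
have -> : row i (copid_mx k) = delta_mx 0 i :> 'rV[R]_q.
  by apply/rowP => j; rewrite !mxE (ltnNge i) ki andbF subr0 eqxx eq_sym.
have -> : row i (pid_mx k : 'M[R]_(q, c)) = 0.
  by apply/rowP => j; rewrite !mxE (ltnNge i) ki andbF.
by rewrite mul0mx addr0 -rowE.
Qed.

Lemma map_mixed_dual (R S : comNzRingType) (f : {rmorphism R -> S}) k B D :
  map_mx f (@mixed_dual R k B D) = mixed_dual k (map_mx f B) (map_mx f D).
Proof. by rewrite map_mxD !map_mxM map_copid_mx map_pid_mx. Qed.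

Lemma frame_E_dual (R : comNzRingType) k E C B D (F : @frame R E C B D) :
  E *m mixed_dual k B D = copid_mx k.
Proof.
by rewrite mulmxDr !mulmxA (frame_EB F) (frame_ED F) mul1mx mul0mx addr0.
Qed.

Lemma frame_C_dual (R : comNzRingType) k E C B D (F : @frame R E C B D) :
  C *m mixed_dual k B D = pid_mx k.
Proof.
by rewrite mulmxDr !mulmxA (frame_CB F) (frame_CD F) mul1mx mul0mx add0r.
Qed.

Lemma mixed_basisK (R : comNzRingType) k E C B D (F : @frame R E C B D) :
  (k <= q)%N -> (k <= c)%N -> mixed_basis k E C *m mixed_dual k B D = 1%:M.
Proof.
move=> kq kc; rewrite mulmxDl -!mulmxA (frame_E_dual k F) (frame_C_dual k F).
by rewrite copid_mx_id // pid_mx_id // /copid_mx subrK.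
Qed.

Lemma mixed_minors (R : comNzRingType) k (E : 'M[R]_(q, n.+1)) (C : 'M[R]_(c, n.+1)) :
  (k <= q)%N -> (k <= c)%N ->
  minors (mixed_basis k E C) = mixminors k E (pid_mx k *m C).
Proof.
move=> kq kc; rewrite mixminors_eq //; last first.
  move=> i j ki; rewrite mxE big1 // => l _.
  by rewrite mxE (ltnNge i) ki andbF mul0r.
congr minors; apply/row_matrixP => i; have [ik|ki] := ltnP i k.
  have ic : (i < c)%N by exact: leq_trans kc.
  rewrite (row_mixed_lt _ _ ik (i' := Ordinal ic)) //; apply/rowP => j.
  rewrite !mxE ik (bigD1 (Ordinal ic)) //= big1 => [|l li].
    by rewrite mxE eqxx ik mul1r addr0.
  rewrite mxE (_ : (i == l :> nat) = false) ?mul0r //.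
  by apply: contraNF li => /eqP il; apply/eqP/val_inj.
by rewrite row_mixed_ge //; apply/rowP => j; rewrite !mxE (ltnNge i) ki.
Qed.

End Frames.

Section FrameExistence.
Variables (K : numClosedFieldType) (n r : nat).
Local Notation q := r.+1.
Local Notation c := (n - r)%N.

Lemma rows_coord (U : {vspace 'rV[K]_n.+1}) (X : seq 'rV[K]_n.+1) q'
    (A : 'M[K]_(q', n.+1)) :
  size X = q' -> (U <= <<X>>)%VS -> (forall i, row i A \in U) ->
  exists G : 'M[K]_q', A = G *m \matrix_(i < q') X`_i.
Proof.
move=> sX UX AU; have tX : size X == q' by rewrite sX.
exists (\matrix_(i, j) coord (Tuple tX) j (row i A)).
apply/row_matrixP => i; rewrite row_mul.
rewrite {1}(@coord_span _ _ _ (Tuple tX) _ (subvP UX _ (AU i))).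
rewrite mulmx_sum_row; apply: eq_bigr => j _ /=.
by rewrite !mxE rowK.
Qed.

Lemma minors_neq0 (A : 'M[K]_(q, n.+1)) (B : 'M[K]_(n.+1, q)) :
  A *m B = 1%:M -> minors A != 0.
Proof.
move=> AB; apply/negP => /eqP A0; have := minors_coform A B.
by rewrite A0 mul0mx mxE AB det1 => /esym/eqP; rewrite oner_eq0.
Qed.

Lemma vlineZ (M : nat) (k : K) (v : 'rV[K]_M) : k != 0 -> <[k *: v]>%VS = <[v]>%VS.
Proof.
move=> k0; apply/eqP; rewrite eqEsubv -!memvE memvZ ?memv_line //=.
by rewrite -{1}(scalerK k0 v) memvZ ?memv_line.
Qed.

Lemma pluckerE (U : {vspace 'rV[K]_n.+1}) (A : 'M[K]_(q, n.+1)) (B : 'M[K]_(n.+1, q)) :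
  \dim U = q -> A *m B = 1%:M -> (forall i, row i A \in U) ->
  plucker r U = <[minors A]>%VS.
Proof.
move=> dU AB AU.
have [|//|G AG] := @rows_coord U (vbasis U) q A _ _ AU.
- by rewrite size_tuple dU.
- by rewrite (span_basis (vbasisP U)).
have := minors_neq0 AB; rewrite {1}AG minors_mulmx scaler_eq0 negb_or => /andP [G0 _].
by rewrite AG minors_mulmx vlineZ.
Qed.

(** The basis is the concatenation of bases of a complement of [U :&: V] in [V],
    of [U :&: V], of a complement of [U :&: V] in [U], and of a complement of
    [U + V]; the first two make up [E] and the last two make up [C]. *)
Lemma adapted_frame (U V : {vspace 'rV[K]_n.+1}) :
  (r < n)%N -> \dim U = q -> \dim V = q ->
  exists k E C B D, [/\ (k <= q)%N, (k <= c)%N, \dim (U :&: V) = (q - k)%N,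
    @frame n r K E C B D & (forall i, row i E \in V) /\
      (forall i, row i (mixed_basis k E C) \in U)].
Proof.
move=> rn dU dV; set W := (U :&: V)%VS.
have dW : (\dim W <= q)%N by rewrite -dU dimvS ?capvSl.
pose k := (q - \dim W)%N.
have kq : (k <= q)%N by exact: leq_subr.
have dWk : \dim W = (q - k)%N by rewrite subKn.
have dUV : \dim (U + V) = (q + k)%N.
  by have := dimv_sum_cap U V; rewrite -/W dU dV; move: dWk kq; lia.
have dfull : \dim (fullv : {vspace 'rV[K]_n.+1}) = n.+1.
  by rewrite dimvf /dim /= mul1n.
have kc : (k <= c)%N.
  by have := dimvS (subvf (U + V)); rewrite dfull dUV; move: rn; lia.
pose Xe := vbasis (V :\: U); pose Xa := vbasis W.
pose Xf := vbasis (U :\: V); pose Xg := vbasis (U + V)^C.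
have de : size Xe = k.
  by rewrite size_tuple; have := dimv_cap_compl V U; rewrite capvC -/W dV; lia.
have da : size Xa = (q - k)%N by rewrite size_tuple.
have df : size Xf = k.
  by rewrite size_tuple; have := dimv_cap_compl U V; rewrite -/W dU; lia.
have dg : size Xg = (c - k)%N.
  by rewrite size_tuple dimv_compl dfull dUV; lia.
pose X := Xe ++ Xa ++ Xf ++ Xg.
have sX : size X = n.+1 by rewrite !size_cat de da df dg; lia.
have spanX : (fullv <= <<X>>)%VS.
  rewrite !span_cat !(span_basis (vbasisP _)) addvA.
  rewrite [X in (_ <= (X + _)%VS)%VS](_ : _ = V); last by rewrite /W capvC addv_diff_cap.
  by rewrite addvA [(V + _)%VS]addvC addv_diff addv_complf.
have [Q QP] : exists Q : 'M[K]_n.+1, 1%:M = Q *m \matrix_(i < n.+1) X`_i.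
  by apply: rows_coord sX spanX _ => i; rewrite memvf.
set P := \matrix_(i < n.+1) _ in QP.
have rowP_ a : (a < n.+1)%N -> row (inord a) P = X`_a.
  by move=> an; rewrite rowK inordK.
have PQ : P *m Q = 1%:M by apply: mulmx1C.
clearbody P.
have PQE a b : (a < n.+1)%N -> (b < n.+1)%N ->
    \sum_j P (inord a) j * Q j (inord b) = (a == b)%:R.
  move=> an bn; have /matrixP /(_ (inord a) (inord b)) := PQ.
  by rewrite !mxE -val_eqE /= !inordK.
have iE (i : 'I_q) : (i < n.+1)%N by have := ltn_ord i; lia.
have iC (i : 'I_c) : (q + i < n.+1)%N by have := ltn_ord i; lia.
exists k, (\matrix_(i, j) P (inord i) j), (\matrix_(i, j) P (inord (q + i)) j),
  (\matrix_(i, j) Q i (inord j)), (\matrix_(i, j) Q i (inord (q + j))).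
split => //.
  split; try (apply/matrixP => i j; rewrite !mxE;
    under eq_bigr do rewrite !mxE; rewrite ?PQE //).
  - by rewrite (_ : (_ == _) = false) //; apply/eqP; have := ltn_ord i; lia.
  - by rewrite (_ : (_ == _) = false) //; apply/eqP; have := ltn_ord j; lia.
  - by rewrite eqn_add2l.
  - under [X in _ + X]eq_bigr do rewrite !mxE.
    have /matrixP /(_ i j) := QP; rewrite !mxE => ->.
    pose G l := Q i (inord l) * P (inord l) j.
    rewrite -(big_mkord xpredT G) -(big_mkord xpredT (fun l => G (q + l)%N)).
    under [RHS]eq_bigr do rewrite -[X in Q _ X * _]inord_val -[X in _ * P X _]inord_val.
    rewrite -(big_mkord xpredT G) [RHS](big_cat_nat _ _ (n := q)) //=; last by lia.
    congr (_ + _); rewrite -[X in _ = \sum_(X <= _ < _) _]add0n [RHS]big_addn subSS.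
    by apply: eq_bigr => l _; rewrite addnC.
split => i.
  rewrite (_ : row i _ = row (inord i) P); last by apply/rowP => j; rewrite !mxE.
  rewrite rowP_ // /X catA nth_cat size_cat de da subnKC // ltn_ord.
  have VX : (<<Xe ++ Xa>> <= V)%VS.
    by rewrite span_cat !(span_basis (vbasisP _)) /W capvC addv_diff_cap.
  by apply/(subvP VX)/memv_span/mem_nth; rewrite size_cat de da subnKC.
have [ik|ki] := ltnP i k.
  have ic : (i < c)%N by exact: leq_trans kc.
  rewrite (row_mixed_lt _ _ ik (i' := Ordinal ic)) //.
  rewrite (_ : row _ _ = row (inord (q + i)) P); last by apply/rowP => j; rewrite !mxE.
  have qi : (q + i < n.+1)%N by move: ic; lia.
  rewrite rowP_ // /X catA nth_cat size_cat de da subnKC // ltnNge leq_addr /=.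
  rewrite addKn nth_cat df ik; apply: (subvP (diffvSl U V)).
  by apply: vbasis_mem; rewrite mem_nth // df.
rewrite row_mixed_ge // (_ : row _ _ = row (inord i) P); last first.
  by apply/rowP => j; rewrite !mxE.
rewrite rowP_ // /X nth_cat de (ltnNge i) ki /= nth_cat da.
rewrite (_ : (i - k < q - k)%N); last by have := ltn_ord i; lia.
apply: (subvP (capvSl U V)).
by apply: vbasis_mem; rewrite mem_nth // da; have := ltn_ord i; lia.
Qed.

End FrameExistence.

(** * Arcs in a chart *)

Notation "A ^pC" := (map_mx polyC A) (at level 1, format "A ^pC") : ring_scope.

Section PolynomialFacts.
Variable K : numClosedFieldType.
Implicit Types p q : {poly K}.

Lemma dvdXnP M p :
  reflect (forall i, (i < M)%N -> p`_i = 0) ('X^M %| p).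
Proof.
apply: (iffP idP) => [/dvdpP [s ->] i iM|p0]; first by rewrite coefMXn iM.
rewrite -(poly_take_drop M p) (_ : take_poly M p = 0) ?add0r ?dvdp_mull //.
by apply/polyP => i; rewrite coef_take_poly coef0; case: ifP => // /p0.
Qed.

Lemma poly_funext p q : (forall x, p.[x] = q.[x]) -> p = q.
Proof.
move=> eq_pq; apply/eqP; rewrite -subr_eq0; apply: contraT => pq0.
have := @max_poly_roots _ _ [seq i%:R | i <- iota 0 (size (p - q))] pq0.
rewrite size_map size_iota ltnn; apply.
  by apply/allP => x _; rewrite rootE !hornerE eq_pq subrr.
by rewrite map_inj_uniq ?iota_uniq // => i j /eqP; rewrite eqr_nat => /eqP.
Qed.

Lemma Gauss_dvdXn M p q k : p.[0] != 0 -> 'X^M %| p ^+ k * q = ('X^M %| q).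
Proof.
move=> p0; rewrite Gauss_dvdpr // coprimep_sym coprimep_expl // coprimep_expr //.
by rewrite coprimepX.
Qed.

Lemma dvdp_sumr (I : finType) d (F : I -> {poly K}) :
  (forall i, d %| F i) -> d %| \sum_i F i.
Proof.
move=> dF; apply: (big_ind (fun p => d %| p)) => [||i _]; last exact: dF.
  by rewrite dvdp0.
by move=> p1 p2; exact: dvdp_add.
Qed.

Lemma dvdXn_mx a b M (Y : 'M[{poly K}]_(a, b)) :
  (forall i j, 'X^M %| Y i j) -> exists Z, Y = 'X^M *: Z.
Proof.
move=> Y0; exists (\matrix_(i, j) (Y i j %/ 'X^M)); apply/matrixP => i j.
by rewrite !mxE mulrC divpK.
Qed.

Lemma det_dvdX s k (A : 'M[{poly K}]_s) : (k <= s)%N ->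
  (forall i j : 'I_s, (j < k)%N -> 'X %| A i j) -> 'X^k %| \det A.
Proof.
move=> ks A0; pose d : 'rV[{poly K}]_s := \row_j (if (j < k)%N then 'X else 1).
have -> : A = (\matrix_(i, j) (A i j %/ d 0 j)) *m diag_mx d.
  apply/matrixP => i j; rewrite mul_mx_diag !mxE divpK //.
  by case: ifP => [/A0 //|_]; rewrite dvd1p.
rewrite det_mulmx det_diag dvdp_mull // (bigID (fun j : 'I_s => (j < k)%N)) /=.
rewrite dvdp_mulr // (eq_bigr (fun=> 'X)) => [|j jk]; last by rewrite mxE jk.
rewrite prodr_const dvdp_exp2l //.
rewrite -[X in (X <= _)%N](card_ord k) -(@card_imset _ _ (widen_ord ks)).
  apply: subset_leq_card; apply/fintype.subsetP => _ /imsetP [j _ ->].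
  exact: (ltn_ord j).
by move=> i j /(congr1 val) /= /val_inj.
Qed.

Lemma horner_polyC_mx a b (A : 'M[K]_(a, b)) x : map_mx (horner_eval x) A^pC = A.
Proof. by apply/matrixP => i j; rewrite !mxE horner_evalE hornerC. Qed.

End PolynomialFacts.

Section Arcs.
Variables (K : numClosedFieldType) (n r : nat).
Local Notation q := r.+1.
Local Notation c := (n - r)%N.
Local Notation N := ('C(n.+1, r.+1)).
Variables (E : 'M[K]_(q, n.+1)) (C : 'M[K]_(c, n.+1)).
Variables (B : 'M[K]_(n.+1, q)) (D : 'M[K]_(n.+1, c)).
Hypothesis F : frame E C B D.

(** A polynomial arc in the space of Pluecker vectors which satisfies the
    equations of [minors_chart] modulo ['X^M] and starts at the point with chart
    coordinates zero, the span of [E]. Both Taylor polynomials of analytic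
    parametrizations and rational curves give such arcs. *)
Record chart_arc M (w : 'rV[{poly K}]_N) : Prop := {
  arc_chart0 : (chart0 B^pC w).[0] != 0;
  arc_chartY : forall i j, (chartY B^pC D^pC w i j).[0] = 0;
  arc_mod : forall k, 'X^M %| chart0 B^pC w ^+ q * w 0 k -
    chart0 B^pC w * minors (chart0 B^pC w *: E^pC + chartY B^pC D^pC w *m C^pC) 0 k }.

Variables (M : nat) (w : 'rV[{poly K}]_N).
Hypothesis arc_w : chart_arc M w.
Let a := chart0 B^pC w.
Let Y := chartY B^pC D^pC w.

Lemma arc_form (h : 'cV[{poly K}]_N) :
  'X^M %| a ^+ q * (w *m h) 0 0 - a * (minors (a *: E^pC + Y *m C^pC) *m h) 0 0.
Proof.
rewrite !mxE !big_distrr -sumrB /=; apply: dvdp_sumr => k.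
by rewrite !mulrA -mulrBl dvdp_mulr //; exact: (arc_mod arc_w).
Qed.

Lemma arc_chartYX : exists Z, Y = 'X *: Z.
Proof.
apply: (@dvdXn_mx _ _ _ 1 Y) => i j; apply/dvdXnP => -[|//] _.
by rewrite -horner_coef0 (arc_chartY arc_w).
Qed.

(** Up to a power of [a], the form dual to [mixed_basis k E C] is a [k]-minor of
    the chart coordinates, and these are multiples of ['X] along the arc. *)
Lemma arc_mixed_dual k :
  (M <= k)%N -> (k <= q)%N -> 'X^M %| (w *m (coform (mixed_dual k B D))^pC) 0 0.
Proof.
move=> Mk kq; have [Z YZ] := arc_chartYX.
have /dvdp_addr := arc_form (coform (mixed_dual k B D))^pC.
rewrite -(@Gauss_dvdXn _ M a _ q) ?(arc_chart0 arc_w) //.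
set u := a ^+ q * _; set v := a * _ => /(_ v) .
have Xv : 'X^M %| v.
  rewrite /v map_coform minors_coform map_mixed_dual YZ.
  have Fc := map_frame (polyC : {rmorphism K -> {poly K}}) F.
  rewrite mulmxDl -scalemxAl -mulmxA (frame_E_dual k Fc) (frame_C_dual k Fc).
  rewrite -scalemxAl.
  rewrite dvdp_mull // (dvdp_trans (dvdp_exp2l 'X Mk)) // det_dvdX //.
  move=> i j jk.
  have -> : (a *: copid_mx k + 'X *: (Z *m pid_mx k)) i j =
      a * ((i == j)%:R - ((i == j) && (i < k)%N)%:R) + 'X * (Z *m pid_mx k) i j.
    by rewrite !mxE.
  rewrite (_ : _ - _ = 0) ?mulr0 ?add0r ?dvdp_mulr //.
  by have [->|_] := eqVneq i j; rewrite /= ?jk subrr.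
by rewrite subrK => ->.
Qed.

(** In the expansion of the minors of [a *: E + Y *m C] in powers of [Y], only the
    constant term [a ^+ q *: minors E] survives modulo ['X^M]. *)
Lemma arc_stationary : (0 < M)%N ->
  (forall i j, 'X^M %| Y i j) -> forall k, 'X^M %| w 0 k - a * (minors E)^pC 0 k.
Proof.
move=> M0 /dvdXn_mx [Z YZ] k.
rewrite -(@Gauss_dvdXn _ M a _ q) ?(arc_chart0 arc_w) //.
have := arc_mod arc_w k; rewrite -/a -/Y => arck.
rewrite -(dvdp_subr _ arck) // YZ -scalemxAl minors_pencil summxE.
rewrite big_ord_recl /= subn0 expr0 mulr1 [in X in _ %| X]mxE mixminors0.
rewrite -map_minors [X in _ * (X + _)](_ : _ = a ^+ q * (minors E)^pC 0 k);
  last by rewrite mxE.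
set s := \sum_(i < _) _.
have Xs : 'X^M %| s.
  apply: dvdp_sumr => i; rewrite mxE; apply/dvdp_mulr/dvdp_mull.
  by rewrite -exprM dvdp_exp2l // leq_pmulr.
rewrite (_ : _ - _ = - (a * s)); last by ring.
by rewrite -mulNr dvdp_mull.
Qed.

(** In the chart, [h] is the sum over [j] of the forms [mixminors j E (_ *m C) *m h]
    of degree [j]. If those of degree less than [k] vanish, then along the arc [h]
    is the value of the form of degree [k] in the initial direction
    [map_mx (horner_eval 0) Z], times a unit and ['X^k], up to higher order. *)
Lemma arc_lowest_term (h : 'cV[K]_N) (Z : 'M[{poly K}]_(q, c)) k :
  Y = 'X *: Z -> (k < M)%N -> (k <= q)%N -> 'X^M %| (w *m h^pC) 0 0 ->
  (forall j (X : 'M[K]_(q, c)), (j < k)%N -> (mixminors j E (X *m C) *m h) 0 0 = 0) ->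
  (mixminors k E (map_mx (horner_eval 0) Z *m C) *m h) 0 0 = 0.
Proof.
move=> YZ kM kq hw low.
pose f j : {poly K} := (mixminors j E^pC (Z *m C^pC) *m h^pC) 0 0.
have fE j x : (f j).[x] = (mixminors j E (map_mx (horner_eval x) Z *m C) *m h) 0 0.
  rewrite (_ : (f j).[x] = map_mx (horner_eval x)
    (mixminors j E^pC (Z *m C^pC) *m h^pC) 0 0); last by rewrite mxE.
  by rewrite map_mxM map_mixminors map_mxM !horner_polyC_mx.
have f0 j : (j < k)%N -> f j = 0.
  by move=> jk; apply: poly_funext => x; rewrite fE horner0 low.
have Hp : 'X^M %| \sum_(j < q.+1) a ^+ (q - j) * 'X^j * f j.
  have := arc_form h^pC; rewrite -/a YZ -scalemxAl minors_pencil mulmx_suml summxE.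
  rewrite (eq_bigr (fun j : 'I_q.+1 => a ^+ (q - j) * 'X^j * f j)) => [|j _].
    have Xw : 'X^M %| a ^+ q * (w *m h^pC) 0 0 by rewrite dvdp_mull.
    by rewrite (dvdp_subr _ Xw) -{1}[a]expr1 Gauss_dvdXn // (arc_chart0 arc_w).
  by rewrite -scalemxAl mxE.
have kq1 : (k < q.+1)%N by [].
have := dvdp_trans (dvdp_exp2l 'X kM) Hp.
rewrite (bigD1 (Ordinal kq1)) //=.
set s := \sum_(i < _ | _) _.
have [t ->] : exists t : {poly K}, s = 'X^(k.+1) * t :> {poly K}.
  suff /dvdpP [t ->] : 'X^(k.+1) %| s by exists t; rewrite mulrC.
  rewrite /s; apply: (big_ind (fun p => 'X^(k.+1) %| p)) => [||j jk].
    - by rewrite dvdp0.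
    - by move=> p1 p2; exact: dvdp_add.
  have [jk'|kj|jk'] := ltngtP j k; first by rewrite f0 // mulr0 dvdp0.
    by apply/dvdp_mulr/dvdp_mull/dvdp_exp2l.
  by case/eqP: jk; apply: val_inj.
have -> : a ^+ (q - k) * 'X^k * f k + 'X^(k.+1) * t =
    'X^k * (a ^+ (q - k) * f k + 'X * t) :> {poly K}.
  by rewrite exprS; ring.
rewrite exprSr dvdp_mul2l ?monic_neq0 ?monicXn //.
rewrite dvdp_addl; last by rewrite dvdp_mulr.
rewrite -['X]expr1 Gauss_dvdXn ?(arc_chart0 arc_w) //.
by move/dvdXnP => /(_ 0%N isT); rewrite -horner_coef0 fE.
Qed.

End Arcs.

(** * Calculus: directional Taylor polynomials *)

Section Taylor.
Variables (K : numClosedFieldType) (s : nat) (U : set 'rV[K]_s).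
Hypothesis U_open : open U.
Local Notation fct := ('rV[K]_s -> K).
Implicit Types (f g : fct) (i : 'I_s) (w : seq 'I_s) (v : 'rV[K]_s).

Definition pd i f : fct := fun t => 'D_(delta_mx 0 i) f t.

(** Off [U] a local parametrization is arbitrary. *)
Definition eq_on f g := forall t, U t -> f t = g t.

Lemma eq_on_near f g t : eq_on f g -> U t -> \near t, f t = g t.
Proof.
by move=> fg Ut; near do apply: fg; exact: open_nbhs_nbhs.
Unshelve. all: by end_near. Qed.

Lemma eq_on_pd i f g : eq_on f g -> eq_on (pd i f) (pd i g).
Proof. by move=> fg t Ut; apply: near_eq_derive; exact: eq_on_near. Qed.

Lemma eq_on_iter_pd i j f g : eq_on f g -> eq_on (iter j (pd i) f) (iter j (pd i) g).
Proof. by move=> fg; elim: j => //= j; exact: eq_on_pd. Qed.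

(** The recursion on the order, rather than a quantification over words of partial
    derivatives, is what the closure under products needs. *)
Fixpoint smooth_upto k f : Prop :=
  if k is k'.+1 then
    forall i, (forall t, U t -> derivable f t (delta_mx 0 i)) /\ smooth_upto k' (pd i f)
  else True.

Definition smooth f := forall k, smooth_upto k f.

Lemma smooth_upto_eq k f g : eq_on f g -> smooth_upto k f -> smooth_upto k g.
Proof.
elim: k f g => //= k IH f g fg sf i; have [df sdf] := sf i; split.
  by move=> t Ut; apply: near_eq_derivable (df t Ut); exact: eq_on_near.
by apply: IH sdf; exact: eq_on_pd.
Qed.

Lemma smooth_eq f g : eq_on f g -> smooth f -> smooth g.
Proof. by move=> fg sf k; exact: smooth_upto_eq (sf k). Qed.

Lemma smooth_uptoW k f : smooth_upto k.+1 f -> smooth_upto k f.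
Proof.
elim: k f => // k IH f sf i; have [df sdf] := sf i.
by split => //; exact: IH.
Qed.

Lemma smooth_derivable i f t : smooth f -> U t -> derivable f t (delta_mx 0 i).
Proof. by move=> sf; have [+ _] := sf 1%N i; apply. Qed.

Lemma smooth_pd i f : smooth f -> smooth (pd i f).
Proof. by move=> sf k; have [] := sf k.+1 i. Qed.

Lemma smooth_iter_pd i j f : smooth f -> smooth (iter j (pd i) f).
Proof. by move=> sf; elim: j => //= j; exact: smooth_pd. Qed.

Lemma pdD i f g : smooth f -> smooth g ->
  eq_on (pd i (fun t => f t + g t)) (fun t => pd i f t + pd i g t).
Proof. by move=> sf sg t Ut; apply: deriveD; exact: smooth_derivable. Qed.

Lemma pdM i f g : smooth_upto 1 f -> smooth_upto 1 g ->
  eq_on (pd i (fun t => f t * g t)) (fun t => pd i f t * g t + f t * pd i g t).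
Proof.
move=> sf sg t Ut; rewrite /pd -[LHS]/('D_(delta_mx 0 i) (f * g) t) deriveM.
- by rewrite addrC /GRing.scale /= [g t * _]mulrC.
- by have [+ _] := sf i; apply.
- by have [+ _] := sg i; apply.
Qed.

Lemma smooth_cst (c : K) : smooth (fun=> c).
Proof.
move=> k; elim: k c => //= k IH c i; split; first by move=> t _; exact: derivable_cst.
apply: smooth_upto_eq (IH 0) => t Ut.
by rewrite /pd derive_cst.
Qed.

Lemma smoothD f g : smooth f -> smooth g -> smooth (fun t => f t + g t).
Proof.
move=> sf sg k; elim: k f g sf sg => //= k IH f g sf sg i; split.
  by move=> t Ut; apply: derivableD; exact: smooth_derivable.
apply: smooth_upto_eq (IH _ _ (smooth_pd i sf) (smooth_pd i sg)) => t Ut.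
by rewrite pdD.
Qed.

Lemma smoothM f g : smooth f -> smooth g -> smooth (fun t => f t * g t).
Proof.
suff H k h h' : smooth_upto k h -> smooth_upto k h' -> smooth_upto k (fun t => h t * h' t).
  by move=> sf sg k; exact: H.
have D k' e e' : smooth_upto k' e -> smooth_upto k' e' ->
    smooth_upto k' (fun t => e t + e' t).
  elim: k' e e' => //= k' IH e e' se se' i.
  have [de sde] := se i; have [de' sde'] := se' i; split.
    by move=> t Ut; apply: derivableD; [exact: de | exact: de'].
  apply: smooth_upto_eq (IH _ _ sde sde') => t Ut.
  by rewrite /pd deriveD //; [exact: de | exact: de'].
elim: k h h' => // k IH h h' sh sh' i.
have [dh sdh] := sh i; have [dh' sdh'] := sh' i; split.
  by move=> t Ut; apply: derivableM; [exact: dh | exact: dh'].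
have W1 e : smooth_upto k.+1 e -> smooth_upto 1 e.
  by move=> se j; have [de _] := se j.
apply: (@smooth_upto_eq _ (fun t => pd i h t * h' t + h t * pd i h' t)).
  by move=> t Ut; rewrite (pdM i (W1 _ sh) (W1 _ sh') Ut).
by apply: D; apply: IH => //; exact: smooth_uptoW.
Qed.

Lemma smooth_sum (I : Type) (e : seq I) (F : I -> fct) :
  (forall j, smooth (F j)) -> smooth (fun t => \sum_(j <- e) F j t).
Proof.
move=> sF; elim: e => [|j e IH].
  by apply: smooth_eq (smooth_cst 0) => t _; rewrite big_nil.
by apply: smooth_eq (smoothD (sF j) IH) => t _; rewrite big_cons.
Qed.

Lemma pd_cst i (c : K) : eq_on (pd i (fun=> c)) (fun=> 0).
Proof. by move=> t _; exact: derive_cst. Qed.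

Lemma pd_scale i (c : K) f :
  smooth f -> eq_on (pd i (fun t => c * f t)) (fun t => c * pd i f t).
Proof.
move=> sf t Ut; rewrite (pdM i (smooth_cst c 1) (sf 1%N) Ut) (pd_cst i c Ut).
by rewrite mul0r add0r.
Qed.

Lemma iter_pd_lin i j (c : K) f g : smooth f -> smooth g ->
  eq_on (iter j (pd i) (fun t => c * f t + g t))
    (fun t => c * iter j (pd i) f t + iter j (pd i) g t).
Proof.
move=> sf sg; elim: j => //= j IH t Ut.
have sf' := smooth_iter_pd i j sf; have sg' := smooth_iter_pd i j sg.
rewrite (eq_on_pd i IH Ut) (pdD i (smoothM (smooth_cst c) sf') sg' Ut).
by rewrite (pd_scale i c sf' Ut).
Qed.

Definition dpd i j f : fct := fun t => j`!%:R^-1 * iter j (pd i) f t.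

Lemma smooth_dpd i j f : smooth f -> smooth (dpd i j f).
Proof. by move=> sf; apply: smoothM; [exact: smooth_cst | exact: smooth_iter_pd]. Qed.

Lemma pd_sum i (I : Type) (e : seq I) (F : I -> fct) : (forall j, smooth (F j)) ->
  eq_on (pd i (fun t => \sum_(j <- e) F j t)) (fun t => \sum_(j <- e) pd i (F j) t).
Proof.
move=> sF t Ut; elim: e => [|j e IH].
  rewrite big_nil -[RHS](@derive_cst _ _ _ (0 : K) t (delta_mx 0 i)).
  by apply: (@eq_on_pd i _ (cst 0)) Ut => x _; rewrite big_nil.
rewrite big_cons -IH -(pdD i (sF j) (smooth_sum e sF) Ut).
by apply: eq_on_pd Ut => x _; rewrite big_cons.
Qed.

Lemma pd_dpd i j f : smooth f ->
  eq_on (pd i (dpd i j f)) (fun t => j.+1%:R * dpd i j.+1 f t).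
Proof.
move=> sf t Ut; rewrite (pd_scale i _ (smooth_iter_pd i j sf) Ut).
by rewrite /dpd factS natrM invfM !mulrA mulfV ?mul1r.
Qed.

Lemma dpdM i j f g : smooth f -> smooth g ->
  eq_on (dpd i j (fun t => f t * g t))
    (fun t => \sum_(a < j.+1) dpd i a f t * dpd i (j - a) g t).
Proof.
move=> sf sg; elim: j => [|j IH] t Ut.
  by rewrite big_ord1 /dpd fact0 invr1 !mul1r.
have j1 : j.+1%:R != 0 :> K by rewrite pnatr_eq0.
apply: (mulfI j1); rewrite -(pd_dpd i j (smoothM sf sg) Ut).
rewrite (eq_on_pd i IH Ut) pd_sum //; last first.
  by move=> a; apply: smoothM; exact: smooth_dpd.
transitivity (\sum_(a < j.+1) (a.+1%:R * (dpd i a.+1 f t * dpd i (j - a) g t)) +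
    \sum_(a < j.+1) ((j.+1 - a)%:R * (dpd i a f t * dpd i (j.+1 - a) g t))).
  rewrite -big_split /=; apply: eq_bigr => a _.
  rewrite (pdM i (smooth_dpd i a sf 1) (smooth_dpd i (j - a) sg 1) Ut).
  by rewrite !pd_dpd // subSn ?leq_ord //; ring.
rewrite big_distrr /= [X in _ + X](_ : _ =
  \sum_(a < j.+2) (j.+1 - a)%:R * (dpd i a f t * dpd i (j.+1 - a) g t)); last first.
  by rewrite [RHS]big_ord_recr /= subnn mul0r addr0.
rewrite [X in X + _](_ : _ =
  \sum_(a < j.+2) a%:R * (dpd i a f t * dpd i (j.+1 - a) g t)); last first.
  rewrite [RHS]big_ord_recl /= mul0r add0r; apply: eq_bigr => a _.
  by rewrite /bump /= add1n subSS.
rewrite -big_split /=; apply: eq_bigr => a _.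
by rewrite -mulrDl -natrD subnKC // leq_ord.
Qed.


Hypothesis U0 : U 0.
Variable M : nat.

(** The Taylor polynomial at the origin, restricted to the line spanned by [v].
    The partial derivatives are composed in the order given by [w], as they are in
    the multi-index derivatives that span the osculating spaces. Truncating each
    variable at order [M] is enough to compute modulo ['X^M]. *)
Fixpoint taylor v w f : {poly K} :=
  if w is i :: w' then
    \sum_(j < M) (v 0 i ^+ j / j`!%:R)%:P * 'X^j * taylor v w' (iter j (pd i) f)
  else (f 0)%:P.

Lemma eq_taylor v w f g : eq_on f g -> taylor v w f = taylor v w g.
Proof.
elim: w f g => [|i w IH] f g fg /=; first by rewrite fg.
by apply: eq_bigr => j _; congr (_ * _); apply: IH; exact: eq_on_iter_pd.
Qed.

Lemma taylor_lin v w (c : K) f g : smooth f -> smooth g ->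
  taylor v w (fun t => c * f t + g t) = c%:P * taylor v w f + taylor v w g.
Proof.
elim: w f g => [|i w IH] f g sf sg /=; first by rewrite polyCD polyCM.
rewrite big_distrr -big_split /=; apply: eq_bigr => j _.
rewrite (eq_taylor v w (iter_pd_lin i j c sf sg)) IH; try exact: smooth_iter_pd.
by ring.
Qed.

Lemma taylorD v w f g : smooth f -> smooth g ->
  taylor v w (fun t => f t + g t) = taylor v w f + taylor v w g.
Proof.
move=> sf sg; rewrite -[X in _ = X + _]mul1r -polyC1 -(taylor_lin _ _ _ sf sg).
by apply: eq_taylor => t _; rewrite mul1r.
Qed.

Lemma taylor0 v w : taylor v w (fun=> 0) = 0.
Proof.
have := taylor_lin v w (-1) (smooth_cst 0) (smooth_cst 0).
rewrite polyCN polyC1 [in RHS]mulN1r addNr => <-; apply: eq_taylor => t _.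
by rewrite mulN1r addNr.
Qed.

Lemma taylor_scale v w (c : K) f : smooth f ->
  taylor v w (fun t => c * f t) = c%:P * taylor v w f.
Proof.
move=> sf; rewrite -[RHS]addr0 -(taylor0 v w) -(taylor_lin _ _ _ sf (smooth_cst 0)).
by apply: eq_taylor => t _; rewrite addr0.
Qed.

Lemma taylor_sum v w (I : Type) (e : seq I) (F : I -> fct) : (forall j, smooth (F j)) ->
  taylor v w (fun t => \sum_(j <- e) F j t) = \sum_(j <- e) taylor v w (F j).
Proof.
move=> sF; elim: e => [|j e IH].
  by rewrite big_nil -(taylor0 v w); apply: eq_taylor => t _; rewrite big_nil.
rewrite big_cons -IH -(taylorD _ _ (sF j) (smooth_sum e sF)).
by apply: eq_taylor => t _; rewrite big_cons.
Qed.

Lemma taylor_cons v i w f : smooth f ->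
  taylor v (i :: w) f = \sum_(j < M) ((v 0 i)%:P * 'X) ^+ j * taylor v w (dpd i j f).
Proof.
move=> sf /=; apply: eq_bigr => j _.
rewrite (taylor_scale v w _ (smooth_iter_pd i j sf)) polyCM exprMn polyC_exp.
by ring.
Qed.

(** Multiplying two sums of [M] powers of a multiple of ['X] and truncating only
    discards multiples of ['X^M]; this is read off from the product of the
    polynomials with coefficients [F] and [G]. *)
Lemma truncated_mul (z : {poly K}) (F G : nat -> {poly K}) : 'X %| z ->
  'X^M %| \sum_(j < M) z ^+ j * (\sum_(a < j.+1) F a * G (j - a)%N) -
    (\sum_(j < M) z ^+ j * F j) * (\sum_(j < M) z ^+ j * G j).
Proof.
move=> Xz; pose P H : {poly {poly K}} := \poly_(j < M) H j.
have PE (H : nat -> {poly K}) : \sum_(j < M) z ^+ j * H j = (P H).[z].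
  rewrite (horner_coef_wide _ (size_poly _ _)); apply: eq_bigr => j _.
  by rewrite coef_poly ltn_ord mulrC.
rewrite !PE -hornerM (@horner_coef_wide _ (M + size (P F * P G))) ?leq_addl //.
rewrite big_split_ord /= opprD addrA -sumrB big1 ?sub0r => [|j _].
  rewrite dvdpNr; apply: dvdp_sumr => j; rewrite dvdp_mull // exprD dvdp_mulr //.
  by rewrite dvdp_exp2r.
rewrite coefM mulrC -mulrBl (_ : _ - _ = 0) ?mul0r //.
apply/eqP; rewrite subr_eq0; apply/eqP; apply: eq_bigr => a _.
rewrite !coef_poly (leq_ltn_trans _ (ltn_ord j)) ?leq_ord //.
by rewrite (leq_ltn_trans (leq_subr _ _) (ltn_ord j)).
Qed.

(** Modulo ['X^M], Taylor expansion is a ring morphism on smooth functions. *)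
Lemma taylorM v w f g : smooth f -> smooth g ->
  'X^M %| taylor v w (fun t => f t * g t) - taylor v w f * taylor v w g.
Proof.
elim: w f g => [|i w IH] f g sf sg; first by rewrite /= polyCM subrr dvdp0.
rewrite !taylor_cons //; last exact: smoothM.
set z := _ * 'X.
have Xz : 'X %| z by rewrite dvdp_mull.
have := truncated_mul (fun a => taylor v w (dpd i a f))
  (fun a => taylor v w (dpd i a g)) Xz.
set p := \sum_(j < M) z ^+ j * \sum_(_ < _) _ => dp.
rewrite -(subrKA p) dvdp_add // {dp}/p -sumrB; apply: dvdp_sumr => j.
rewrite -mulrBr dvdp_mull //.
have sfg (a : 'I_j.+1) : smooth (fun t => dpd i a f t * dpd i (j - a) g t).
  by apply: smoothM; exact: smooth_dpd.
rewrite (eq_taylor v w (dpdM i j sf sg)) (taylor_sum v w _ sfg) -sumrB.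
by apply: dvdp_sumr => a; apply: IH; exact: smooth_dpd.
Qed.

Lemma taylor_at0 v w f : (0 < M)%N -> (taylor v w f).[0] = f 0.
Proof.
move=> M0; elim: w f => [|i w IH] f /=; first by rewrite hornerC.
rewrite -(prednK M0) big_ord_recl /= hornerD horner_sum big1 ?addr0.
  by rewrite !expr0 fact0 divr1 polyC1 !mul1r IH.
by move=> j _; rewrite !hornerM hornerXn expr0n mulr0 mul0r.
Qed.

Lemma taylor_coef v i w f d : (taylor v (i :: w) f)`_d = \sum_(j < M)
  v 0 i ^+ j / j`!%:R * (if (d < j)%N then 0 else (taylor v w (iter j (pd i) f))`_(d - j)).
Proof.
by rewrite /= coef_sum; apply: eq_bigr => j _; rewrite -mulrA coefCM coefXnM.
Qed.

Lemma taylor_coef1 v w f : (1 < M)%N ->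
  (taylor v w f)`_1 = \sum_(i <- w) v 0 i * pd i f 0.
Proof.
move=> M1; elim: w f => [|i w IH] f; first by rewrite /= big_nil coefC.
rewrite taylor_coef (bigD1 (Ordinal (ltnW M1))) // (bigD1 (Ordinal M1)) //=.
rewrite big1 ?addr0 => [|j /andP [j0 j1]]; last first.
  by rewrite ifT ?mulr0 // ltn_neqAle eq_sym j1 lt0n.
rewrite expr0 fact0 divr1 mul1r IH expr1 divr1 subnn -horner_coef0.
by rewrite taylor_at0 ?(ltnW M1) // big_cons addrC.
Qed.

Definition mpd w (I : 'I_s -> nat) f : fct := foldl (fun g i => iter (I i) (pd i) g) f w.

Lemma eq_mpd w (I I' : 'I_s -> nat) f : {in w, I =1 I'} -> mpd w I f = mpd w I' f.
Proof.
elim: w f => //= i w IH f II'; rewrite /mpd /= -!/(mpd _ _ _) II' ?mem_head //.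
by apply: IH => j jw; apply: II'; rewrite in_cons jw orbT.
Qed.

Lemma eq_taylor_dir v v' w f : {in w, v 0 =1 v' 0} -> taylor v w f = taylor v' w f.
Proof.
elim: w f => //= i w IH f vv'; rewrite vv' ?mem_head //; apply: eq_bigr => j _.
by rewrite IH // => l lw; apply: vv'; rewrite in_cons lw orbT.
Qed.

(** The Taylor polynomials along all directions detect the vanishing of all mixed
    partial derivatives of low order: the dependence on the coordinate [v 0 i] is
    polynomial, and its coefficients isolate the powers of [pd i]. *)
Lemma taylor_dvdXnP w f M' : uniq w -> (M' <= M)%N ->
  (forall v, 'X^M' %| taylor v w f) <->
  (forall I, (\sum_(i <- w) I i < M')%N -> mpd w I f 0 = 0).
Proof.
elim: w f M' => [|i w IH] f M'.
  move=> _ _; rewrite /mpd /=; split=> [/(_ 0) /dvdXnP f0 I|f0 v].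
    by rewrite big_nil => /f0; rewrite coefC.
  apply/dvdXnP => d dM; rewrite coefC (f0 (fun=> 0%N)) ?big_nil ?if_same //.
  by rewrite (leq_ltn_trans _ dM).
move=> /= /andP [iw uw] M'M; split=> [Tf I|If v]; last first.
  apply/dvdXnP => d dM; rewrite -/(taylor v (i :: w) f) taylor_coef big1 // => j _.
  case: ltnP => [_|jd]; first by rewrite mulr0.
  have M'jM := leq_trans (leq_subr j M') M'M.
  have [_ /(_ _ v) /dvdXnP ->] := IH (iter j (pd i) f) (M' - j)%N uw M'jM.
  - by rewrite mulr0.
  - move=> I IM; pose I' l := if l == i then j : nat else I l.
    have I'w : {in w, I =1 I'}.
      by move=> l lw; rewrite /I'; case: eqP => // li; rewrite -li lw in iw.
    have := If I'; rewrite big_cons /mpd /= /I' eqxx -/I' -/(mpd w I' _).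
    rewrite -(eq_mpd _ I'w); apply.
    rewrite (eq_big_seq I) => [|l lw]; last exact/esym/I'w.
    by rewrite -ltn_subRL.
  - by rewrite ltn_sub2r // (leq_ltn_trans jd).
rewrite big_cons => IM; rewrite /mpd /= -/(mpd w I _).
have [+ _] := IH (iter (I i) (pd i) f) (M' - I i)%N uw (leq_trans (leq_subr _ _) M'M).
apply; last by rewrite ltn_subRL.
move=> v; apply/dvdXnP => d; rewrite ltn_subRL => dM.
(* the coefficient of ['X^(d + I i)], as a polynomial in the coordinate [v 0 i] *)
pose A j := (taylor v w (iter j (pd i) f))`_(d + I i - j).
pose P : {poly K} := \poly_(j < M) (if (d + I i < j)%N then 0 else A j / j`!%:R).
suff : P = 0.
  move/(congr1 (fun p : {poly K} => p`_(I i))); rewrite coef0 coef_poly.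
  rewrite (leq_ltn_trans _ (leq_trans dM M'M)) ?leq_addr // ltnNge leq_addl /= /A addnK.
  by move/eqP; rewrite mulf_eq0 invr_eq0 pnatr_eq0 -leqn0 leqNgt fact_gt0 orbF => /eqP.
apply: poly_funext => x; rewrite horner0 (horner_coef_wide _ (size_poly _ _)).
pose v' : 'rV[K]_s := \row_l (if l == i then x else v 0 l).
have /dvdXnP /(_ (d + I i)%N) := Tf v'.
rewrite addnC => /(_ dM); rewrite -/(taylor v' (i :: w) f) taylor_coef => coef0E.
rewrite -[RHS]coef0E.
apply: eq_bigr => j _; rewrite coef_poly ltn_ord mxE eqxx [(I i + d)%N]addnC.
case: ltnP => _; first by rewrite mul0r mulr0.
rewrite /A (@eq_taylor_dir v v') ?[A _ * _]mulrC; first by ring.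
by move=> l lw; rewrite mxE; case: eqP => // li; rewrite -li lw in iw.
Qed.

(** As a relation, Taylor expansion modulo ['X^M] passes through every polynomial
    expression, in particular through determinants. *)
Definition has_taylor v w f (p : {poly K}) : Prop :=
  smooth f /\ 'X^M %| taylor v w f - p.

Lemma has_taylor_taylor v w f : smooth f -> has_taylor v w f (taylor v w f).
Proof. by move=> sf; split=> //; rewrite subrr dvdp0. Qed.

Lemma has_taylor_unique v w f g p p' : eq_on f g ->
  has_taylor v w f p -> has_taylor v w g p' -> 'X^M %| p - p'.
Proof.
move=> fg [_ fp] [_ gp]; rewrite (_ : p - p' =
  (taylor v w g - p') - (taylor v w f - p)); first by rewrite dvdp_sub.
by rewrite (eq_taylor _ _ fg); ring.
Qed.

Lemma has_taylor_eq v w f g p : eq_on f g -> has_taylor v w f p -> has_taylor v w g p.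
Proof.
by move=> fg [sf fp]; split; [exact: smooth_eq sf | rewrite -(eq_taylor _ _ fg)].
Qed.

Lemma has_taylorD v w f g p p' : has_taylor v w f p -> has_taylor v w g p' ->
  has_taylor v w (fun t => f t + g t) (p + p').
Proof.
move=> [sf fp] [sg gp]; split; first exact: smoothD.
by rewrite taylorD // opprD addrACA dvdp_add.
Qed.

Lemma has_taylorM v w f g p p' : has_taylor v w f p -> has_taylor v w g p' ->
  has_taylor v w (fun t => f t * g t) (p * p').
Proof.
move=> [sf fp] [sg gp]; split; first exact: smoothM.
rewrite (_ : _ - _ =
  (taylor v w (fun t => f t * g t) - taylor v w f * taylor v w g) +
  ((taylor v w f - p) * taylor v w g + p * (taylor v w g - p'))); last by ring.
apply: dvdp_add; first exact: taylorM.
by apply: dvdp_add; [exact: dvdp_mulr | exact: dvdp_mull].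
Qed.

Lemma has_taylor_cst v w (c : K) : has_taylor v w (fun=> c) c%:P.
Proof.
split; first exact: smooth_cst.
have : 'X^M %| taylor v w (fun=> 1) - 1.
  elim: w => [|i w IH] /=; first by rewrite subrr dvdp0.
  have [->|M0] := posnP M; first by rewrite dvd1p.
  rewrite (bigD1 (Ordinal M0)) //= big1 => [|j j0].
    by rewrite !expr0 fact0 divr1 polyC1 !mul1r addr0.
  rewrite (eq_taylor v w (g := fun=> 0)) ?taylor0 ?mulr0 // => t Ut.
  case: j j0 => -[//|j] jM _ /=; elim: j {jM} t Ut => [|j IHj] t Ut /=.
    exact: pd_cst.
  by rewrite (eq_on_pd i IHj Ut) pd_cst.
rewrite (_ : taylor v w (fun=> c) = c%:P * taylor v w (fun=> 1)).
  by move=> d1; rewrite -[X in _ - X]mulr1 -mulrBr dvdp_mull.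
rewrite -(taylor_scale _ _ _ (smooth_cst 1)); apply: eq_taylor => t _.
by rewrite mulr1.
Qed.

Lemma has_taylor_sum v w (I : Type) (e : seq I) (F : I -> fct) p :
  (forall j, has_taylor v w (F j) (p j)) ->
  has_taylor v w (fun t => \sum_(j <- e) F j t) (\sum_(j <- e) p j).
Proof.
move=> Fp; elim: e => [|j e IH].
  rewrite big_nil -polyC0; apply: has_taylor_eq (has_taylor_cst v w 0) => t _.
  by rewrite big_nil.
rewrite big_cons; apply: has_taylor_eq (has_taylorD (Fp j) IH) => t _.
by rewrite big_cons.
Qed.

Lemma has_taylor_prod v w (I : Type) (e : seq I) (F : I -> fct) p :
  (forall j, has_taylor v w (F j) (p j)) ->
  has_taylor v w (fun t => \prod_(j <- e) F j t) (\prod_(j <- e) p j).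
Proof.
move=> Fp; elim: e => [|j e IH].
  rewrite big_nil -polyC1; apply: has_taylor_eq (has_taylor_cst v w 1) => t _.
  by rewrite big_nil.
rewrite big_cons; apply: has_taylor_eq (has_taylorM (Fp j) IH) => t _.
by rewrite big_cons.
Qed.

Lemma has_taylor_exp v w f p k : has_taylor v w f p ->
  has_taylor v w (fun t => f t ^+ k) (p ^+ k).
Proof.
move=> fp; elim: k => [|k IH]; first by rewrite expr0 -polyC1; exact: has_taylor_cst.
rewrite exprS; apply: has_taylor_eq (has_taylorM fp IH) => t _.
by rewrite exprS.
Qed.

Lemma has_taylor_det v w a (A : 'rV[K]_s -> 'M[K]_a) (P : 'M[{poly K}]_a) :
  (forall k l, has_taylor v w (fun t => A t k l) (P k l)) ->
  has_taylor v w (fun t => \det (A t)) (\det P).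
Proof.
move=> AP; apply: has_taylor_sum => u; apply: has_taylorM; last first.
  exact: has_taylor_prod.
by rewrite -(rmorph_sign polyC); exact: has_taylor_cst.
Qed.

End Taylor.

(** * Linear forms and holomorphic maps *)

Section LinearForms.
Variables (K : numClosedFieldType) (N : nat).

Definition form_ker (h : 'cV[K]_N) : {vspace 'rV[K]_N} :=
  lker (linfun (mulmxr h : 'rV[K]_N -> 'M[K]_1)).

Lemma mem_form_ker (h : 'cV[K]_N) (x : 'rV[K]_N) :
  (x \in form_ker h) = ((x *m h) 0 0 == 0).
Proof.
rewrite memv_ker lfunE /=; apply/eqP/eqP => [->|xh]; first by rewrite mxE.
by apply/matrixP => i j; rewrite !ord1 xh mxE.
Qed.

Lemma separating_form (W : {vspace 'rV[K]_N}) (x : 'rV[K]_N) : x \notin W ->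
  exists2 h : 'cV[K]_N, (W <= form_ker h)%VS & (x *m h) 0 0 != 0.
Proof.
move=> xW; pose y := x - projv W x.
have y0 : y != 0.
  by apply: contraNneq xW => /eqP; rewrite subr_eq0 => /eqP ->; exact: memv_proj.
have [j yj] : exists j, y 0 j != 0.
  apply/existsP; apply: contraNT y0 => /existsPn y0; apply/eqP/rowP => j.
  by rewrite [RHS]mxE; apply/eqP; move/negPn: (y0 j).
pose P : 'M[K]_N := 1%:M - lin1_mx (projv W).
have PE z : z *m P = z - projv W z by rewrite mulmxBr mulmx1 mul_rV_lin1.
exists (P *m delta_mx j 0).
  apply/subvP => z zW; rewrite mem_form_ker mulmxA PE projv_id // subrr.
  by rewrite mul0mx mxE eqxx.
by rewrite mulmxA PE -colE mxE.
Qed.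

End LinearForms.

Section Forms.
Variables (K : numClosedFieldType) (s N : nat) (U : set 'rV[K]_s).
Hypothesis U_open : open U.
Implicit Types (psi : 'rV[K]_s -> 'rV[K]_N) (h : 'cV[K]_N).

Definition form h psi : 'rV[K]_s -> K := fun t => (psi t *m h) 0 0.

Lemma form_continuous h : continuous (fun x : 'rV[K]_N => (x *m h) 0 0).
Proof.
move=> x; apply: differentiable_continuous.
rewrite (_ : (fun x => _) = \sum_(j < N) (fun y : 'rV[K]_N => y 0 j * h j 0)).
  apply: differentiable_sum => j; apply: (@differentiableM _ _ (fun y : 'rV[K]_N => y 0 j)).
    exact: differentiable_coord.
  exact: differentiable_cst.
by apply/funext => y; rewrite mxE fct_sumE.
Qed.

Lemma is_derive_form h psi t v : derivable psi t v ->
  is_derive t v (form h psi) (('D_v psi t *m h) 0 0).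
Proof.
move=> dpsi; pose L (x : 'rV[K]_N) : K := (x *m h) 0 0.
have cvgL : (fun e => e^-1 *: ((form h psi \o shift t) (e *: v) - form h psi t)) @ 0^'
    --> L ('D_v psi t).
  have -> : (fun e => e^-1 *: ((form h psi \o shift t) (e *: v) - form h psi t)) =
      L \o (fun e => e^-1 *: ((psi \o shift t) (e *: v) - psi t)).
    apply/funext => e; rewrite /= /L /form -scalemxAl mulmxBl [RHS]mxE; congr (_ * _).
    by rewrite [RHS]mxE [X in _ = _ + X]mxE.
  apply: continuous_cvg dpsi; exact: form_continuous.
by split; [apply/cvg_ex; exists (L ('D_v psi t)) | exact: cvg_lim cvgL].
Qed.

Definition holomorphic psi :=
  forall (w : seq 'I_s) t, U t -> differentiable (foldr (@partial K s N) psi w) t.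

Lemma holomorphic_partial i psi : holomorphic psi -> holomorphic (partial i psi).
Proof. by move=> hpsi w t Ut; have := hpsi (rcons w i) t Ut; rewrite -cats1 foldr_cat. Qed.

Lemma holomorphic_derivable psi v t : holomorphic psi -> U t -> derivable psi t v.
Proof. by move=> hpsi Ut; apply: diff_derivable; exact: (hpsi [::]). Qed.

Lemma pd_form i h psi : holomorphic psi ->
  eq_on U (pd i (form h psi)) (form h (partial i psi)).
Proof.
move=> hpsi t Ut; have dpsi := holomorphic_derivable (v := delta_mx 0 i) hpsi Ut.
exact: (derive_val (is_derive := is_derive_form h dpsi)).
Qed.

Lemma smooth_form h psi : holomorphic psi -> smooth U (form h psi).
Proof.
move=> hpsi k; elim: k psi hpsi => //= k IH psi hpsi i; split.
  move=> t Ut; have dpsi := holomorphic_derivable (v := delta_mx 0 i) hpsi Ut.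
  exact: (ex_derive (is_derive := is_derive_form h dpsi)).
apply: (smooth_upto_eq U_open) (IH _ (holomorphic_partial i hpsi)) => t Ut.
by rewrite pd_form.
Qed.

Lemma mpd_form (I : 'I_s -> nat) h psi : holomorphic psi ->
  eq_on U (mpd (rev (enum 'I_s)) I (form h psi)) (form h (mpartial I psi)).
Proof.
move=> hpsi; rewrite /mpd /mpartial foldl_rev.
suff [] : eq_on U (foldr (fun i => iter (I i) (pd i)) (form h psi) (enum 'I_s))
    (form h (foldr (fun i => iter (I i) (partial i)) psi (enum 'I_s))) /\
    holomorphic (foldr (fun i => iter (I i) (partial i)) psi (enum 'I_s)) by [].
elim: (enum 'I_s) => [|i w [IHe IHh]] //=.
elim: (I i) => [|j [IHe' IHh']] //=; split; last exact: holomorphic_partial.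
by move=> t Ut; rewrite (eq_on_pd U_open i IHe' Ut) pd_form.
Qed.

End Forms.

(** * Osculating spaces of the Grassmannian *)

Section OsculatingArcs.
Variables (K : numClosedFieldType) (n r : nat).
Local Notation q := r.+1.
Local Notation c := (n - r)%N.
Local Notation N := ('C(n.+1, r.+1)).
Local Notation s := (r.+1 * (n - r))%N.

Lemma grassmannian_minors (x : 'rV[K]_N) :
  grassmannian K n r <[x]>%VS -> exists k A, x = k *: minors A.
Proof.
case=> W _ Wx; have : x \in plucker r W by rewrite Wx memv_line.
case/vlineP => k ->; exists k, (\matrix_(i < r.+1) (vbasis W)`_i).
by congr (_ *: _).
Qed.

Variables (p : {vspace 'rV[K]_N}) (l : 'cV[K]_N).
Variables (U : set 'rV[K]_s) (phi : 'rV[K]_s -> 'rV[K]_N).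
Hypothesis phiP : local_parametrization (grassmannian K n r) p l U phi.
Variables (E : 'M[K]_(q, n.+1)) (C : 'M[K]_(c, n.+1)).
Variables (B : 'M[K]_(n.+1, q)) (D : 'M[K]_(n.+1, c)).
Hypothesis F : frame E C B D.
Hypothesis pE : p = <[minors E]>%VS.

Let U_open : open U := lp_open phiP.
Let U0 : U 0 := lp_0 phiP.
Let phi_holo : holomorphic U phi := @lp_holo _ _ _ _ _ _ _ _ phiP.
Let vars := rev (enum 'I_s).

Lemma phi_chart t : U t ->
  (phi t *m l) 0 0 = 1 /\ exists k A, phi t = k *: minors A.
Proof.
move=> Ut; have [W _ imW] := lp_image phiP.
have : (phi @` U) (phi t) by exists t.
by rewrite imW => -[[lt /grassmannian_minors]].
Qed.

Lemma phi0_minors : exists2 k, k != 0 & phi 0 = k *: minors E.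
Proof.
have : phi 0 \in p by rewrite -(lp_p phiP) memv_line.
rewrite pE => /vlineP [k phi0]; exists k => //.
apply/eqP => k0; have [] := phi_chart U0.
by rewrite phi0 k0 scale0r mul0mx mxE => /esym/eqP; rewrite oner_eq0.
Qed.

(** The directional Taylor polynomials of [phi] are arcs on the Grassmannian, so the
    polynomial identities of the chart apply to them. *)
Definition phi_taylor M v : 'rV[{poly K}]_N :=
  \row_j taylor M v vars (form (delta_mx j 0) phi).

Lemma form_delta j t : form (delta_mx j 0) phi t = phi t 0 j.
Proof. by rewrite /form -colE mxE. Qed.

Let coord_smooth j : smooth U (form (delta_mx j 0) phi).
Proof. exact: smooth_form. Qed.

Lemma formE h t : form h phi t = \sum_j h j 0 * form (delta_mx j 0) phi t.
Proof. by rewrite /form mxE; apply: eq_bigr => j _; rewrite -colE mxE mulrC. Qed.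

Lemma taylor_form M v h :
  taylor M v vars (form h phi) = (phi_taylor M v *m h^pC) 0 0.
Proof.
rewrite (eq_taylor U_open U0 M v vars (fun t _ => formE h t)).
rewrite (taylor_sum U_open U0) => [|j]; last first.
  by apply: (smoothM U_open) => //; exact: smooth_cst.
rewrite mxE; apply: eq_bigr => j _; rewrite (taylor_scale U_open U0) //.
by rewrite !mxE mulrC.
Qed.

Lemma has_taylor_form M v h :
  has_taylor U M v vars (form h phi) ((phi_taylor M v *m h^pC) 0 0).
Proof. by rewrite -taylor_form; apply: has_taylor_taylor; exact: smooth_form. Qed.

Lemma chartY_form (w : 'rV[{poly K}]_N) i j :
  chartY B^pC D^pC w i j = (w *m (coform (replace_col B D i j))^pC) 0 0.
Proof.
rewrite mxE map_coform; congr ((_ *m coform _) 0 0).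
by apply/matrixP => a b; rewrite !mxE; case: ifP.
Qed.

Lemma phi_taylor_arc M v : (0 < M)%N -> chart_arc E C B D M (phi_taylor M v).
Proof.
move=> M0; have [k k0 phi0] := phi0_minors.
have chart0E t : chart0 B (phi t) = form (coform B) phi t by [].
have chartYE t i j :
    chartY B D (phi t) i j = form (coform (replace_col B D i j)) phi t.
  by rewrite mxE.
have chart0T : chart0 B^pC (phi_taylor M v) =
    (phi_taylor M v *m (coform B)^pC) 0 0 by rewrite map_coform.
have chartYT i j := chartY_form (phi_taylor M v) i j.
split=> [|i j|j].
- rewrite chart0T -taylor_form taylor_at0 // -chart0E phi0 chart0Z.
  by rewrite (chart0_frame F) mulr1.
- rewrite chartYT -taylor_form taylor_at0 // -chartYE phi0 chartYZ.
  by rewrite (chartY_frame F) scaler0 mxE.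
have H0 : has_taylor U M v vars (fun t => chart0 B (phi t)) (chart0 B^pC (phi_taylor M v)).
  by rewrite chart0T; exact: has_taylor_form.
have HY i k' : has_taylor U M v vars (fun t => chartY B D (phi t) i k')
    (chartY B^pC D^pC (phi_taylor M v) i k').
  rewrite chartYT; apply: (has_taylor_eq U_open U0) (has_taylor_form M v _) => t _.
  by rewrite chartYE.
have Hj : has_taylor U M v vars (fun t => phi t 0 j) (phi_taylor M v 0 j).
  rewrite mxE; apply: (has_taylor_eq U_open U0) (has_taylor_taylor _ _ _ (coord_smooth j)).
  by move=> t _; rewrite form_delta.
have Hm : has_taylor U M v vars
    (fun t => minors (chart0 B (phi t) *: E + chartY B D (phi t) *m C) 0 j)
    (minors (chart0 B^pC (phi_taylor M v) *: E^pC +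
             chartY B^pC D^pC (phi_taylor M v) *m C^pC) 0 j).
  rewrite mxE; apply: (has_taylor_eq U_open U0) (has_taylor_det U_open U0 (A := fun t =>
    colsub (@selection n r j) (chart0 B (phi t) *: E + chartY B D (phi t) *m C)) _).
    by move=> t _; rewrite mxE.
  move=> a b; pose b' := selection j b.
  have entry (R : comNzRingType) (x : R) E' Y' C' : colsub (@selection n r j)
      (x *: E' + Y' *m C' : 'M[R]_(q, n.+1)) a b =
      x * E' a b' + \sum_(i < c) Y' a i * C' i b'.
    by rewrite !mxE.
  rewrite entry.
  apply: (has_taylor_eq U_open U0 (f := fun t => chart0 B (phi t) * E a b' +
      \sum_(i < c) chartY B D (phi t) a i * C i b')).
    by move=> t _; rewrite entry.
  apply: (has_taylorD U_open U0).
    by apply: (has_taylorM U_open U0) => //; rewrite mxE; exact: has_taylor_cst.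
  apply: (has_taylor_sum U_open U0) => i.
  by apply: (has_taylorM U_open U0) => //; rewrite mxE; exact: has_taylor_cst.
apply: (has_taylor_unique U_open U0 _
  (has_taylorM U_open U0 (has_taylor_exp U_open U0 q H0) Hj)
  (has_taylorM U_open U0 H0 Hm)) => t Ut.
have [_ [a [A phit]]] := phi_chart Ut.
have /rowP /(_ j) := minors_chart F A a; rewrite -phit.
by rewrite mxE [RHS]mxE.
Qed.

(** Square because [phi] is defined on a space of the dimension of the chart. *)
Let dchart : 'M[K]_s :=
  \matrix_(i, j) mxvec (\matrix_(a, b)
     pd i (form (coform (replace_col B D a b)) phi) 0) 0 j.

Let dchartE v : v *m dchart = mxvec (\matrix_(a, b)
  (\sum_(i <- vars) v 0 i * pd i (form (coform (replace_col B D a b)) phi) 0)).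
Proof.
apply/rowP => j; rewrite mxE; case/mxvec_indexP: j => a b; rewrite mxvecE mxE.
rewrite /vars big_rev /= -big_enum /=; apply: eq_bigr => i _.
by rewrite mxE mxvecE mxE.
Qed.

Let chartY_coef1 M v a b : (1 < M)%N ->
  (chartY B^pC D^pC (phi_taylor M v) a b)`_1 = vec_mx (v *m dchart) a b.
Proof.
move=> M1; rewrite dchartE mxvecK [RHS]mxE.
rewrite -(taylor_coef1 v vars (form _ phi) M1) taylor_form.
by rewrite chartY_form.
Qed.

Lemma diff_phi v : 'd phi 0 v = \sum_i v 0 i *: partial i phi 0.
Proof.
rewrite {1}[v]row_sum_delta linear_sum; apply: eq_bigr => i _.
rewrite linearZ /=; congr (_ *: _).
by rewrite /partial deriveE //; exact: (phi_holo [::] U0).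
Qed.

(** Since [phi] is an immersion into a chart of the Grassmannian, which has the
    same dimension, its differential is bijective in the coordinates of that
    chart. Indeed, a direction which is killed there is mapped by the
    differential of [phi] to a multiple of [phi 0], which has to vanish because
    [phi] stays in the affine hyperplane where [l] is [1]. *)
Let dchart_unit : dchart \in unitmx.
Proof.
rewrite -row_free_unit -kermx_eq0; apply/eqP/row_matrixP => i0; rewrite row0.
set v := row i0 _; have v0 : v *m dchart = 0.
  by apply/sub_kermxP; rewrite row_sub.
apply: (lp_immersion phiP U0); rewrite linear0.
have arc := @phi_taylor_arc 2 v isT.
have Y0 a b : 'X^2 %| chartY B^pC D^pC (phi_taylor 2 v) a b.
  apply/dvdXnP => -[|[|//]] _; first by rewrite -horner_coef0 (arc_chartY arc).
  by rewrite chartY_coef1 // v0 linear0 mxE.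
set a1 := (chart0 B^pC (phi_taylor 2 v))`_1.
have dphi (h : 'cV[K]_N) : ('d phi 0 v *m h) 0 0 = ((phi_taylor 2 v *m h^pC) 0 0)`_1.
  rewrite -taylor_form taylor_coef1 // /vars big_rev /= big_enum /= diff_phi.
  rewrite mulmx_suml summxE; apply: eq_bigr => i _.
  by rewrite -scalemxAl mxE (pd_form i h phi_holo U0).
have dphiE (h : 'cV[K]_N) : ('d phi 0 v *m h) 0 0 = a1 * (minors E *m h) 0 0.
  rewrite dphi !mxE coef_sum big_distrr /=; apply: eq_bigr => j _.
  have /dvdXnP /(_ 1%N isT) /eqP := arc_stationary arc isT Y0 j.
  rewrite coefB subr_eq0 [_^pC 0 j]mxE [h^pC j 0]mxE => /eqP wj.
  by rewrite coefMC wj coefMC mulrA.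
have dl : ('d phi 0 v *m l) 0 0 = 0.
  have l1 : eq_on U (form l phi) (fun=> 1) by move=> t /phi_chart [].
  rewrite dphi -taylor_form taylor_coef1 // big1 // => i _.
  by rewrite (eq_on_pd U_open i l1 U0) (pd_cst i 1 U0) mulr0.
have El : (minors E *m l) 0 0 != 0.
  have [k k0 phi0] := phi0_minors; have [+ _] := phi_chart U0.
  rewrite phi0 -scalemxAl mxE; apply: contra_eqN => /eqP ->.
  by rewrite mulr0 eq_sym oner_eq0.
have a10 : a1 = 0.
  by move/eqP: dl; rewrite dphiE mulf_eq0 (negbTE El) orbF => /eqP.
apply/rowP => j; rewrite [RHS]mxE.
have := dphiE (delta_mx j 0); rewrite a10 mul0r => <-.
by rewrite -colE mxE.
Qed.

Lemma phi_taylor_direction M (X : 'M[K]_(q, c)) : (1 < M)%N ->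
  exists v Z, chartY B^pC D^pC (phi_taylor M v) = 'X *: Z /\ map_mx (horner_eval 0) Z = X.
Proof.
move=> M1; pose v := mxvec X *m invmx dchart; exists v.
have [Z YZ] := arc_chartYX (phi_taylor_arc v (ltnW M1)).
exists Z; split=> //; apply/matrixP => a b.
have := chartY_coef1 v a b M1; rewrite mulmxKV // mxvecK YZ => <-.
by rewrite !mxE horner_evalE mulrC coefMX horner_coef0.
Qed.

Lemma osculating_taylor m (h : 'cV[K]_N) :
  (forall I : 'I_s -> nat, (\sum_i I i < m)%N -> (mpartial I phi 0 *m h) 0 0 = 0) <->
  (forall v, 'X^m %| (phi_taylor m v *m h^pC) 0 0).
Proof.
have uv : uniq vars by rewrite rev_uniq enum_uniq.
have [Tm mT] := taylor_dvdXnP (form h phi) uv (leqnn m).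
have sumI (I : 'I_s -> nat) : (\sum_(i <- vars) I i = \sum_i I i)%N.
  by rewrite /vars big_rev /= big_enum.
split=> [hI v|hT I Im].
  rewrite -taylor_form; apply: mT => I Im.
  by rewrite (mpd_form U_open I h phi_holo U0); apply: hI; rewrite -sumI.
have := Tm _ I; rewrite (mpd_form U_open I h phi_holo U0); apply; last by rewrite sumI.
by move=> v; rewrite taylor_form.
Qed.

Lemma affine_osculating_sub m (W : {vspace 'rV[K]_N}) :
  (forall a, affine_osculating phi m a -> a \in W) <->
  (forall I : 'I_s -> nat, (\sum_i I i <= m)%N -> mpartial I phi 0 \in W).
Proof.
have mp0 (I : 'I_s -> nat) : (\sum_i I i = 0)%N -> mpartial I phi = phi.
  move/eqP; rewrite sum_nat_eq0 => /forallP I0; rewrite /mpartial.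
  by elim: (enum _) => //= i w ->; rewrite (eqP (I0 i)).
split=> [WA I Im|WI a].
  have phiW : phi 0 \in W by apply: WA; rewrite /affine_osculating /= subrr mem0v.
  have [/mp0 -> //|I0] := posnP (\sum_i I i)%N.
  have Ii i : (I i < m.+1)%N by rewrite ltnS (leq_trans _ Im) // (bigD1 i) //= leq_addr.
  pose J := [ffun i => inord (I i) : 'I_m.+1].
  have JE i : J i = I i :> nat by rewrite ffunE inordK.
  have -> : mpartial I phi 0 = mpartial (fun i => J i) phi 0.
    by rewrite (_ : (fun i => J i : nat) = I) //; apply/funext.
  rewrite -[mpartial _ _ _](addrK (phi 0)) -[X in X \in _]addrC.
  rewrite memvD ?memvN //; apply: WA; rewrite /affine_osculating /= addrK.
  apply: (subvP (sumv_sup J _ (subvv _))); last exact: memv_line.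
  by rewrite (eq_bigr I) ?I0.
rewrite /affine_osculating /= => aW; rewrite -[a](subrK (phi 0)) memvD //.
  apply: subvP aW; apply/subv_sumP => I /andP [_ Im]; rewrite -memvE.
  exact: WI.
by rewrite -(mp0 (fun=> 0%N)) ?big1 //; apply: WI; rewrite big1.
Qed.

(** For [m < k] the form dual to the mixed basis kills all partial derivatives of
    order at most [m], by [arc_mixed_dual], but not the point. For [k <= m], a form
    that kills the osculating space vanishes to order greater than [m] along [phi]
    in every direction, so by induction and [arc_lowest_term] its homogeneous terms
    of degree at most [m] in the chart vanish; the value at the point is one of
    them. *)
Lemma osculating_mixed k m : (k <= q)%N -> (k <= c)%N -> (0 < m)%N ->
  osculating_space phi m <[minors (mixed_basis k E C)]>%VS <-> (k <= m)%N.
Proof.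
move=> kq kc m0; have mixK := mixed_basisK F kq kc.
split=> [[_ osc]|km].
  rewrite leqNgt; apply/negP => mk; pose h := coform (mixed_dual k B D).
  suff /osc : forall a, affine_osculating phi m a -> a \in form_ker h.
    by rewrite -memvE mem_form_ker minors_coform mixK det1 oner_eq0.
  apply/affine_osculating_sub => I Im; rewrite mem_form_ker; apply/eqP.
  apply: (osculating_taylor m.+1 h).2 => // v.
  exact: (arc_mixed_dual F (phi_taylor_arc v (ltn0Sn m))).
split; first by rewrite dim_vline (minors_neq0 mixK).
move=> W /affine_osculating_sub WI; rewrite -memvE; apply/negPn/negP.
case/separating_form => h Wh /eqP; apply.
have /osculating_taylor hT : forall I : 'I_s -> nat, (\sum_i I i < m.+1)%N ->
    (mpartial I phi 0 *m h) 0 0 = 0.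
  by move=> I Im; apply/eqP; rewrite -mem_form_ker (subvP Wh) // WI.
have lowest j (X : 'M[K]_(q, c)) : (j <= k)%N -> (mixminors j E (X *m C) *m h) 0 0 = 0.
  elim/ltn_ind: j X => j IH X jk.
  have [v [Z [YZ <-]]] := @phi_taylor_direction m.+1 X m0.
  apply: (arc_lowest_term (phi_taylor_arc v (ltn0Sn m)) YZ _ _ (hT v)).
  - by rewrite ltnS (leq_trans jk).
  - exact: leq_trans kq.
  - by move=> j' X' j'j; apply: IH => //; exact: leq_trans (ltnW j'j) jk.
by rewrite mixed_minors // lowest.
Qed.

End OsculatingArcs.

(** * Binary forms and hyperplane sections *)

Section BinaryForms.
Variables (K : numClosedFieldType) (N : nat).

Definition monomials e (x y : K) : 'rV[K]_e.+1 := \row_j (x ^+ (e - j) * y ^+ j).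

Lemma formsE e (A : 'M[K]_(e.+1, N)) x y : forms A x y = monomials e x y *m A.
Proof. by rewrite mulmx_sum_row; apply: eq_bigr => j _; rewrite mxE. Qed.

Lemma monomials_scale e k (x y : K) :
  monomials e (k * x) (k * y) = k ^+ e *: monomials e x y.
Proof.
apply/rowP => j; rewrite !mxE !exprMn.
have -> : k ^+ e = k ^+ (e - j) * k ^+ j by rewrite -exprD subnK ?leq_ord.
by ring.
Qed.

Lemma forms_normalize e (A : 'M[K]_(e.+1, N)) x y : (x, y) != (0, 0) ->
  <[forms A x y]>%VS = if y == 0 then <[forms A 1 0]>%VS else <[forms A (x / y) 1]>%VS.
Proof.
move=> xy0; have [y0|y0] := eqVneq y 0.
  have x0 : x != 0 by apply: contraNneq xy0 => ->; rewrite y0.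
  rewrite y0 (_ : forms A x 0 = x ^+ e *: forms A 1 0) ?vlineZ ?expf_neq0 //.
  by rewrite !formsE scalemxAl -monomials_scale mulr1 mulr0.
rewrite (_ : forms A x y = y ^+ e *: forms A (x / y) 1) ?vlineZ ?expf_neq0 //.
by rewrite !formsE scalemxAl -monomials_scale mulr1 mulrC divfK.
Qed.

(** The dehomogenization at [y = 1] of the binary form with coefficients [b]; since
    [b 0 0] is the coefficient of [x ^+ e], the order is reversed. *)
Definition bpoly e (b : 'cV[K]_e.+1) : {poly K} :=
  \poly_(i < e.+1) b (inord (e - i)) 0.

Lemma horner_bpoly e (b : 'cV[K]_e.+1) x : (bpoly b).[x] = (monomials e x 1 *m b) 0 0.
Proof.
rewrite horner_poly mxE (reindex_inj rev_ord_inj) /=; apply: eq_bigr => j _.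
rewrite subSS mxE expr1n mulr1 mulrC; congr (_ * b _ _).
by apply: val_inj; rewrite /= inordK subKn ?leq_ord // ltnS leq_ord.
Qed.

Lemma bpoly_lin e (b b' : 'cV[K]_e.+1) k : bpoly (b + k *: b') = bpoly b + k%:P * bpoly b'.
Proof.
apply: poly_funext => x; rewrite !hornerE !horner_bpoly mulmxDr -scalemxAr.
by rewrite !mxE.
Qed.

Lemma bpoly_eq0 e (b : 'cV[K]_e.+1) : bpoly b = 0 -> b = 0.
Proof.
move=> b0; apply/colP => j; have /(congr1 (fun p : {poly K} => p`_(e - j))) := b0.
rewrite coef_poly coef0 ltnS leq_subr mxE subKn ?leq_ord // => <-.
by congr (b _ _); apply: val_inj; rewrite /= inordK.
Qed.

Lemma coef_bpoly e (b : 'cV[K]_e.+1) : (bpoly b)`_e = b ord0 0.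
Proof.
rewrite coef_poly ltnS leqnn subnn; congr (b _ _).
by apply: val_inj; rewrite /= inordK.
Qed.

Lemma monomials10 e (b : 'cV[K]_e.+1) : (monomials e 1 0 *m b) 0 0 = b ord0 0.
Proof.
rewrite mxE (bigD1 ord0) //= big1 => [|j j0].
  by rewrite addr0 !mxE expr1n mul1r expr0 mul1r.
by rewrite !mxE expr0n -val_eqE /= in j0 *; rewrite (negbTE j0) mulr0 mul0r.
Qed.

Lemma size_bpoly e (b : 'cV[K]_e.+1) : (size (bpoly b) <= e + (b ord0 0 != 0)%R)%N.
Proof.
have [b0|_] := eqVneq (b ord0 0) 0; last by rewrite addn1 size_poly.
rewrite addn0; apply/leq_sizeP => j; rewrite leq_eqVlt => /predU1P [<-|ej].
  by rewrite coef_bpoly.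
by rewrite coef_poly ltnS leqNgt ej.
Qed.

Lemma bpoly_size e (b : 'cV[K]_e.+1) : b ord0 0 != 0 -> size (bpoly b) = e.+1.
Proof.
move=> b0; apply/eqP; rewrite eqn_leq size_poly /= ltnNge; apply: contraNN b0.
by move=> /leq_sizeP /(_ e (leqnn e)); rewrite coef_bpoly => ->.
Qed.

Lemma poly_roots (p : {poly K}) : p != 0 ->
  exists2 rs, size rs = (size p).-1 & forall x, root p x = (x \in rs).
Proof.
move=> p0; have [rs pE] := closed_field_poly_normal p.
have l0 : lead_coef p != 0 by rewrite lead_coef_eq0.
exists rs; first by rewrite pE size_scale // size_prod_XsubC.
by move=> x; rewrite pE rootZ // root_prod_XsubC.
Qed.

Lemma hyperplane_form (H : {vspace 'rV[K]_N}) : (\dim H).+1 = N ->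
  exists2 h : 'cV[K]_N, h != 0 & H = form_ker h.
Proof.
move=> dH; have dN : \dim {:'rV[K]_N} = N by rewrite dimvf /dim /= mul1n.
have [x xH] : exists x, x \notin H.
  apply: contrapT => nx; have /dimvS : (fullv <= H)%VS.
    by apply/subvP => x _; apply/negPn/negP => xH; apply: nx; exists x.
  by rewrite dN -{1}dH ltnn.
have [h Hh xh] := separating_form xH; exists h.
  by apply: contraNneq xh => ->; rewrite mulmx0 mxE.
apply/eqP; rewrite eqEdim Hh /= -ltnS dH ltn_neqAle.
rewrite -[X in (_ <= X)%N]dN dimvS ?subvf // andbT -[X in _ != X]dN.
apply: contraNneq xh => dker; rewrite -mem_form_ker.
by rewrite (_ : form_ker h = fullv) ?memvf //; apply/eqP; rewrite eqEdim subvf dker /=.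
Qed.

Lemma dim_form_ker (h : 'cV[K]_N) : h != 0 -> (\dim (form_ker h)).+1 = N.
Proof.
move=> h0; have := limg_ker_dim (linfun (mulmxr h : 'rV[K]_N -> 'M[K]_1)) fullv.
rewrite capfv -/(form_ker h) [X in _ = X]dimvf [dim _]mul1n => dN.
apply: etrans dN; rewrite -addn1; congr (_ + _)%N; apply/eqP; rewrite eqn_leq.
have -> /= : (\dim (linfun (mulmxr h : 'rV[K]_N -> 'M[K]_1) @: fullv) <= 1)%N.
  by rewrite (leq_trans (dimvS (subvf _))) // dimvf /dim /= mul1n.
rewrite andbT lt0n dimv_eq0; apply: contraNneq h0 => im0.
apply/eqP/colP => j; rewrite mxE.
have : linfun (mulmxr h : 'rV[K]_N -> 'M[K]_1) (delta_mx 0 j) \in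
    (linfun (mulmxr h : 'rV[K]_N -> 'M[K]_1) @: fullv)%VS.
  by rewrite memv_img ?memvf.
rewrite im0 memv0 lfunE /= -rowE => /eqP /matrixP /(_ 0 0).
by rewrite !mxE.
Qed.

Lemma section_bound e (A : 'M[K]_(e.+1, N)) (h : 'cV[K]_N) : A *m h != 0 ->
  exists2 k, (k <= e)%N & (hyperplane_section (P1_image A) (form_ker h) #= `I_k)%card.
Proof.
move=> Ah0; set S := hyperplane_section _ _; set b := A *m h.
have p0 : bpoly b != 0 by apply: contraNneq Ah0 => /bpoly_eq0 b0; exact/eqP/b0.
have [rs srs rsE] := poly_roots p0.
pose pts := (if b ord0 0 == 0 then [:: <[forms A 1 0]>%VS] else [::]) ++
  [seq <[forms A x 1]>%VS | x <- rs].
have spts : (size pts <= e)%N.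
  rewrite size_cat size_map srs; have := size_bpoly b.
  have := size_poly_eq0 (bpoly b); rewrite (negbTE p0).
  by case: (b ord0 0 == 0) => /=; case: (size _) => [|z] //= _; lia.
have Sle : (S #<= `I_(size pts))%card.
  apply: card_le_trans (card_image_le (fun i => nth 0%VS pts i) _).
  apply: subset_card_le => L SL; suff Lpts : L \in pts.
    by exists (seq.index L pts); rewrite ?nth_index //= index_mem.
  move: SL => [[x [y [xy0 ->]]]]; rewrite forms_normalize // mem_cat.
  case: eqP => [_|_]; rewrite -memvE mem_form_ker formsE -mulmxA -/b.
    by rewrite monomials10 => ->; rewrite mem_head.
  rewrite -horner_bpoly -rootE rsE => rx; apply/orP; right.
  by apply/mapP; exists (x / y); rewrite ?formsE.
have /finite_setP [k Sk] : finite_set S.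
  by apply: card_le_finite Sle _; exact: finite_II.
by exists k => //; rewrite (leq_trans _ spts) // -card_le_II -(card_le_eql Sk).
Qed.

Lemma section_lower e (A : 'M[K]_(e.+1, N)) (h : 'cV[K]_N) rs k :
  P1_embedding A -> uniq rs -> (forall x, x \in rs -> root (bpoly (A *m h)) x) ->
  (hyperplane_section (P1_image A) (form_ker h) #= `I_k)%card -> (size rs <= k)%N.
Proof.
move=> embA urs rsP Sk; rewrite -card_le_II -(card_le_eqr Sk).
pose f i := <[forms A rs`_i 1]>%VS.
have n01 (x : K) : (x, 1) != (0, 0) :> K * K.
  by apply/eqP => -[_ /eqP]; rewrite oner_eq0.
have f_inj : {in `I_(size rs) &, injective f}.
  move=> i j; rewrite !inE /= => ir jr /(P1_inj embA (n01 _) (n01 _)).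
  by rewrite !mulr1 => /eqP; rewrite nth_uniq // => /eqP.
rewrite -(card_le_eql (inj_card_eq f_inj)); apply: subset_card_le => _ [i ir <-].
split; first by exists (nth 0 rs i), 1.
rewrite -memvE mem_form_ker formsE -mulmxA -horner_bpoly -rootE.
exact: rsP (mem_nth 0 ir).
Qed.

End BinaryForms.

(** * The degree of a rational curve *)

Section Degree.
Variables (K : numClosedFieldType) (N : nat).

Lemma poly_nonroot (p : {poly K}) : p != 0 -> exists x, p.[x] != 0.
Proof. by case/closed_nonrootP => x; exists x. Qed.

Lemma nonvanishing_form (vs : seq 'rV[K]_N) : all (fun v => v != 0) vs ->
  exists h : 'cV[K]_N, forall v, v \in vs -> (v *m h) 0 0 != 0.
Proof.
(* the form with coefficients the powers of a sufficiently general x *)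
move=> vs0; pose P (v : 'rV[K]_N) : {poly K} :=
  \poly_(i < N) (if insub i is Some j then v 0 j else 0).
have PE v x : (P v).[x] = (v *m \col_j x ^+ j) 0 0.
  rewrite horner_poly mxE; apply: eq_bigr => j _.
  by rewrite valK mxE.
have P0 : \prod_(v <- vs) P v != 0.
  rewrite prodf_seq_neq0; apply: sub_all vs0 => v v0 /=; apply: contraNneq v0 => Pv.
  apply/eqP/rowP => j; have /(congr1 (fun p : {poly K} => p`_j)) := Pv.
  by rewrite coef_poly ltn_ord valK coef0 mxE.
have [x] := poly_nonroot P0; rewrite horner_prod prodf_seq_neq0 => /allP nx.
by exists (\col_j x ^+ j) => v /nx; rewrite PE.
Qed.

Lemma separable_roots (p : {poly K}) : p != 0 ->
  (forall x, root p x -> ~~ root p^`() x) ->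
  exists rs, [/\ uniq rs, size rs = (size p).-1 & forall x, x \in rs -> root p x].
Proof.
move=> p0 simple; have [rs pE] := closed_field_poly_normal p.
have l0 : lead_coef p != 0 by rewrite lead_coef_eq0.
exists rs; split.
- rewrite -separable_prod_XsubC; apply: (@dvdp_separable _ p).
    by rewrite pE dvdpZr.
  rewrite unlock; apply: Pdiv.ClosedField.root_coprimep => x.
  exact: simple.
- by rewrite pE size_scale // size_prod_XsubC.
- by move=> x; rewrite pE rootZ // root_prod_XsubC.
Qed.

(** A special case of Bertini's theorem. The form [h1] is chosen not to vanish at
    [(1 : 0)] and [h2] not to vanish where [h1] does, so the two sections have no
    common zero. A multiple zero of a member of their pencil is a zero of the
    Wronskian, and at each of these finitely many points at most one member of
    the pencil vanishes. *)
Lemma transverse_form e (A : 'M[K]_(e.+1, N)) : (0 < e)%N ->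
  (forall x y, (x, y) != (0, 0) -> forms A x y != 0) ->
  exists h : 'cV[K]_N, exists rs, [/\ uniq rs, size rs = e, A *m h != 0 &
    forall x, x \in rs -> root (bpoly (A *m h)) x].
Proof.
move=> e0 bpf.
have n10 : (1, 0) != (0, 0) :> K * K.
  by apply/eqP => -[/eqP]; rewrite oner_eq0.
have n01 (x : K) : (x, 1) != (0, 0) :> K * K.
  by apply/eqP => -[_ /eqP]; rewrite oner_eq0.
have [|h1 /(_ _ (mem_head _ _))] := @nonvanishing_form [:: forms A 1 0].
  by rewrite /= bpf.
rewrite formsE -mulmxA monomials10 => b1.
set p1 := bpoly (A *m h1); have sp1 : size p1 = e.+1 by exact: bpoly_size.
have p10 : p1 != 0 by rewrite -size_poly_eq0 sp1.
have [rs1 srs1 rs1E] := poly_roots p10.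
have [|h2 h2P] := @nonvanishing_form [seq forms A x 1 | x <- rs1].
  by apply/allP => _ /mapP [x _ ->]; exact: bpf.
set p2 := bpoly (A *m h2).
have p12 x : root p1 x -> p2.[x] != 0.
  rewrite rs1E => xrs; rewrite horner_bpoly mulmxA -formsE.
  by apply: h2P; exact: map_f.
pose W := p1^`() * p2 - p1 * p2^`().
have W0 : W != 0.
  apply/negP; rewrite subr_eq0 => /eqP W0.
  have : p1 %| p1^`().
    rewrite -(@Gauss_dvdpl _ _ p2) ?W0 ?dvdp_mulr //.
    exact: Pdiv.ClosedField.root_coprimep.
  have dp0 : p1^`() != 0.
    apply/eqP => /(congr1 (fun p : {poly K} => p`_e.-1)); rewrite coef_deriv coef0.
    rewrite prednK // coef_bpoly => /eqP.
    by rewrite mulrn_eq0 (negbTE b1) orbF -leqn0 leqNgt e0.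
  by move/(dvdp_leq dp0); rewrite leqNgt lt_size_deriv.
have [ws sws wsE] := poly_roots W0.
pose line (a b : K) : {poly K} := a%:P + b *: 'X.
have line_neq0 a b : (a != 0) || (b != 0) -> line a b != 0.
  case/orP => ab; apply: contraNneq ab => l0.
    have /(congr1 (fun p : {poly K} => p`_0)) := l0.
    by rewrite coefD coefC coefZ coefX mulr0 addr0 coef0 => ->.
  have /(congr1 (fun p : {poly K} => p`_1)) := l0.
  by rewrite coefD coefC coefZ coefX mulr1 add0r coef0 => ->.
(* a value of the parameter where T does not vanish gives a form of degree e, none
   of whose zeros is a zero of the Wronskian *)
pose T := line ((A *m h1) ord0 0) ((A *m h2) ord0 0) *
  \prod_(w <- ws) line p1.[w] p2.[w].
have [|t] := @poly_nonroot T.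
  rewrite mulf_neq0 ?line_neq0 ?b1 // prodf_seq_neq0; apply/allP => w _ /=.
  by apply: line_neq0; have [/p12 -> | -> //] := boolP (root p1 w); rewrite orbT.
have lineE a b : (line a b).[t] = a + t * b by rewrite !hornerE mulrC.
rewrite hornerM mulf_eq0 negb_or lineE horner_prod prodf_seq_neq0 => /andP [bt /allP nt].
have AhE : A *m (h1 + t *: h2) = A *m h1 + t *: (A *m h2) by rewrite mulmxDr scalemxAr.
exists (h1 + t *: h2); rewrite AhE bpoly_lin -/p1 -/p2.
have bt' : (A *m h1 + t *: (A *m h2)) ord0 0 != 0 by rewrite !mxE in bt *.
have [|x|rs [urs srs rsE]] := @separable_roots (p1 + t%:P * p2).
- by rewrite -bpoly_lin -size_poly_eq0 bpoly_size.
- rewrite !rootE => /eqP px; apply/eqP => dpx.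
  have p1x : p1.[x] = - (t * p2.[x]).
    by apply/eqP; rewrite -addr_eq0; move: px; rewrite !hornerE => ->.
  have dp1x : p1^`().[x] = - (t * p2^`().[x]).
    apply/eqP; rewrite -addr_eq0; move: dpx.
    by rewrite derivD derivM derivC mul0r add0r !hornerE => ->.
  have xws : x \in ws.
    by rewrite -wsE rootE /W !hornerE p1x dp1x; apply/eqP; ring.
  by have := nt _ xws; rewrite /= lineE p1x addNr eqxx.
exists rs; split=> //.
  by rewrite srs -bpoly_lin bpoly_size.
by apply: contraNneq bt' => ->; rewrite mxE.
Qed.

(** A transverse hyperplane section has as many points as the degree of the forms. *)
Lemma curve_degree_ge e (A : 'M[K]_(e.+1, N)) d :
  P1_embedding A -> curve_degree (P1_image A) d -> (e <= d)%N.
Proof.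
move=> embA [_ sec]; have [->//|e0] := posnP e.
have [h [rs [urs srs Ah0 rsE]]] := transverse_form e0 (P1_base_point_free embA).
have h0 : h != 0 by apply: contraNneq Ah0 => ->; rewrite mulmx0.
have [||k kd Sk] := sec (form_ker h); first exact: dim_form_ker.
  move=> Ch; case/negP: Ah0; apply/eqP/bpoly_eq0/poly_funext => x.
  rewrite horner0 horner_bpoly mulmxA -formsE; apply/eqP; rewrite -mem_form_ker memvE.
  apply: Ch; exists x, 1; split=> //.
  by apply/eqP => -[_ /eqP]; rewrite oner_eq0.
by rewrite (leq_trans _ kd) // -[X in (X <= _)%N]srs (section_lower embA urs rsE Sk).
Qed.

Lemma free_pair (u v : 'rV[K]_N) :
  (forall a b, a *: u + b *: v = 0 -> a = 0 /\ b = 0) -> free [:: u; v].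
Proof.
move=> indep; rewrite free_cons seq1_free span_seq1; apply/andP; split.
  apply/negP => /vlineP [k uv]; have [] := indep 1 (- k).
    by rewrite uv scale1r scaleNr subrr.
  by move/eqP; rewrite oner_eq0.
apply/negP => /eqP v0; have [] := indep 0 1.
  by rewrite v0 scale0r scaler0 addr0.
by move=> _ /eqP; rewrite oner_eq0.
Qed.

Section RationalNormalForms.
Variables (k : nat) (G : 'M[K]_(k.+1, N)) (L : 'M[K]_(N, k.+1)).
Hypotheses (k0 : (0 < k)%N) (GL : G *m L = 1%:M).

Let formsK x y : forms G x y *m L = monomials k x y.
Proof. by rewrite formsE -mulmxA GL mulmx1. Qed.

Lemma monomials_neq0 (x y : K) : (x, y) != (0, 0) -> monomials k x y != 0.
Proof.
move=> xy0; apply: contraNneq xy0 => /rowP m0.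
have := m0 ord0; rewrite !mxE mulr1 subn0 => /eqP; rewrite expf_eq0 k0 => /eqP ->.
by have := m0 ord_max; rewrite !mxE subnn mul1r => /eqP; rewrite expf_eq0 k0 => /eqP ->.
Qed.

Lemma monomials_inj (x y x' y' : K) a :
  (x, y) != (0, 0) -> monomials k x y = a *: monomials k x' y' -> x * y' = x' * y.
Proof.
move=> xy0 mE; have a0 : a != 0.
  by have := monomials_neq0 xy0; rewrite mE scaler_eq0 negb_or => /andP [].
have m0 : x * x ^+ k.-1 = a * (x' * x' ^+ k.-1).
  by have /rowP /(_ ord0) := mE; rewrite !mxE !mulr1 subn0 -!exprS prednK.
have m1 : x ^+ k.-1 * y = a * (x' ^+ k.-1 * y').
  by have /rowP /(_ (inord 1)) := mE; rewrite !mxE inordK // subn1.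
have [x0|x0] := eqVneq x 0.
  move/esym/eqP: m0; rewrite x0 mul0r mulf_eq0 (negbTE a0) -exprS prednK //.
  by rewrite expf_eq0 k0 => /eqP ->; rewrite !mul0r.
have xk : x ^+ k.-1 != 0 by rewrite expf_neq0.
apply: (mulfI xk); rewrite [RHS]mulrCA m1 [LHS]mulrCA [LHS]mulrA m0; ring.
Qed.

Lemma rational_normal_embedding : P1_embedding G.
Proof.
split=> [x y xy0|x y x' y' xy0 _ eqL|x y xy0].
- apply: contraNneq (monomials_neq0 xy0) => G0.
  by rewrite -formsK G0 mul0mx.
- have /vlineP [a] : forms G x y \in <[forms G x' y']>%VS by rewrite -eqL memv_line.
  move/(congr1 (mulmx^~ L)); rewrite -scalemxAl !formsK.
  exact: monomials_inj.
apply: free_pair => a b ab0.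
have ab j : (j <= k)%N -> a * ((k - j)%:R * x ^+ (k - j).-1 * y ^+ j) +
    b * (j%:R * x ^+ (k - j) * y ^+ j.-1) = 0.
  move=> jk; have dE : forms_dx G x y = (\row_(j < k.+1)
      ((k - j)%:R * x ^+ (k - j).-1 * y ^+ j)) *m G.
    by rewrite mulmx_sum_row; apply: eq_bigr => i _; rewrite mxE.
  have dE' : forms_dy G x y = (\row_(j < k.+1)
      (j%:R * x ^+ (k - j) * y ^+ j.-1)) *m G.
    by rewrite mulmx_sum_row; apply: eq_bigr => i _; rewrite mxE.
  move: ab0; rewrite dE dE' !scalemxAl -mulmxDl => /(congr1 (mulmx^~ L)).
  rewrite mul0mx -mulmxA GL mulmx1 => /rowP /(_ (inord j)).
  by rewrite !mxE !inordK.
have kR : k%:R != 0 :> K by rewrite pnatr_eq0 -lt0n.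
have [y0|y0] := eqVneq y 0.
  have x0 : x != 0 by apply: contraNneq xy0 => ->; rewrite y0.
  have xk : x ^+ k.-1 != 0 by rewrite expf_neq0.
  have a0 : a = 0.
    apply/eqP; move/eqP: (ab 0%N isT); rewrite subn0 !mul0r mulr0 addr0 mulr1.
    by rewrite !mulf_eq0 (negbTE kR) (negbTE xk) !orbF.
  split=> //; apply/eqP; move/eqP: (ab 1%N k0).
  by rewrite a0 mul0r add0r subn1 mul1r mulr1 mulf_eq0 (negbTE xk) orbF.
have yk : y ^+ k.-1 != 0 by rewrite expf_neq0.
have b0 : b = 0.
  apply/eqP; move/eqP: (ab k (leqnn k)); rewrite subnn !mul0r mulr0 add0r mulr1.
  by rewrite !mulf_eq0 (negbTE kR) (negbTE yk) !orbF.
split=> //; apply/eqP; move/eqP: (ab k.-1 (leq_pred k)).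
rewrite b0 mul0r addr0 (_ : k - k.-1 = 1)%N; last by move: k0; lia.
by rewrite !mul1r mulf_eq0 (negbTE yk) orbF.
Qed.

Lemma form_ker_curve (h : 'cV[K]_N) :
  (forall M, P1_image G M -> (M <= form_ker h)%VS) -> G *m h = 0.
Proof.
move=> Gh; apply/bpoly_eq0/poly_funext => x.
rewrite horner0 horner_bpoly mulmxA -formsE; apply/eqP; rewrite -mem_form_ker memvE.
apply: Gh; exists x, 1; split=> //.
by apply/eqP => -[_ /eqP]; rewrite oner_eq0.
Qed.

Lemma rational_normal_degree : curve_degree (P1_image G) k.
Proof.
split=> [|H dH CH].
  pose rs : seq K := [seq i%:R | i <- iota 0 k].
  have urs : uniq rs.
    by rewrite map_inj_uniq ?iota_uniq // => i j /eqP; rewrite eqr_nat => /eqP.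
  pose P : {poly K} := \prod_(x <- rs) ('X - x%:P).
  have sP : size P = k.+1 by rewrite size_prod_XsubC size_map size_iota.
  pose h := L *m \col_(j < k.+1) P`_(k - j).
  have bE : bpoly (G *m h) = P.
    rewrite /h mulmxA GL mul1mx; apply/polyP => i; rewrite coef_poly ltnS.
    case: ltnP => [ki|ik]; first by rewrite nth_default // sP.
    by rewrite mxE inordK ?subKn // ltnS leq_subr.
  have Gh0 : G *m h != 0.
    apply/eqP => Gh0; have := sP; rewrite -bE Gh0.
    rewrite (_ : bpoly 0 = 0) ?size_poly0 //.
    by apply/polyP => i; rewrite coef_poly mxE coef0 if_same.
  have [k' kk' Sk] := section_bound Gh0.
  exists (form_ker h); split.
  - by apply: dim_form_ker; apply: contraNneq Gh0 => ->; rewrite mulmx0.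
  - by move/form_ker_curve/eqP; rewrite (negbTE Gh0).
  - rewrite [X in `I_X](_ : k = k') //; apply/eqP; rewrite eqn_leq kk' andbT.
    have := section_lower rational_normal_embedding urs _ Sk.
    rewrite size_map size_iota; apply=> x xrs.
    by rewrite bE root_prod_XsubC.
have [h h0 HE] := hyperplane_form dH; rewrite HE in CH *.
apply: section_bound; apply/eqP => Gh0; apply: CH => _ [x [y [_ ->]]].
by rewrite -memvE mem_form_ker formsE -mulmxA Gh0 mulmx0 mxE eqxx.
Qed.

Lemma rational_normal_forms : rational_normal_curve (P1_image G) k.
Proof.
split.
- by exists k, G; split=> //; exact: rational_normal_embedding.
- exact: rational_normal_degree.
pose f := linfun (mulmxr G : 'rV[K]_k.+1 -> 'rV[K]_N).
exists (f @: fullv)%VS; last first.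
  rewrite limg_dim_eq ?dimvf ?[dim _]mul1n // capfv; apply/eqP; rewrite -subv0.
  apply/subvP => u; rewrite memv_ker memv0 lfunE /= => /eqP uG.
  by rewrite -[u]mulmx1 -GL mulmxA uG mul0mx.
split=> [_ [x [y [_ ->]]]|W' CW'].
  rewrite -memvE formsE (_ : _ *m G = f (monomials k x y)) ?memv_img ?memvf //.
  by rewrite lfunE.
apply/subvP => _ /memv_imgP [u _ ->]; rewrite lfunE /=; apply/negPn/negP.
case/separating_form => h W'h /eqP; apply.
rewrite -mulmxA form_ker_curve ?mulmx0 ?mxE // => M CM.
exact: subv_trans (CW' M CM) W'h.
Qed.

End RationalNormalForms.

End Degree.

(** * Rational curves on the Grassmannian *)

Section CurvesOnGrassmannian.
Variables (K : numClosedFieldType) (n r : nat).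
Local Notation q := r.+1.
Local Notation c := (n - r)%N.
Local Notation N := ('C(n.+1, r.+1)).
Variables (E : 'M[K]_(q, n.+1)) (C : 'M[K]_(c, n.+1)).
Variables (B : 'M[K]_(n.+1, q)) (D : 'M[K]_(n.+1, c)).
Hypothesis F : frame E C B D.

Section Arc.
Variables (e : nat) (A : 'M[K]_(e.+1, N)) (x0 y0 x1 y1 : K).
Hypothesis A_cone : forall x y, exists k M, forms A x y = k *: @minors n r K M.

(** Parametrized so that [0] gives the first point and [1] the second one. *)
Definition line_arc : 'rV[{poly K}]_N :=
  (\row_(j < e.+1) ((x0%:P + (x1 - x0) *: 'X) ^+ (e - j) *
                    (y0%:P + (y1 - y0) *: 'X) ^+ j)) *m A^pC.

Lemma horner_line_arc t : map_mx (horner_eval t) line_arc =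
  forms A (x0 + (x1 - x0) * t) (y0 + (y1 - y0) * t).
Proof.
rewrite map_mxM horner_polyC_mx formsE; congr (_ *m _).
by apply/rowP => j; rewrite !mxE /= horner_evalE !hornerE.
Qed.

Lemma size_line_arc (h : 'cV[K]_N) : (size ((line_arc *m h^pC) 0 0)%R <= e.+1)%N.
Proof.
have lin (a b : K) j : (size ((a%:P + b *: 'X) ^+ j)%R <= j.+1)%N.
  have s2 : (size (a%:P + b *: 'X)%R <= 2)%N.
    rewrite (leq_trans (size_polyD _ _)) // geq_max (leq_trans (size_polyC_leq1 _)) //=.
    by rewrite (leq_trans (size_scale_leq _ _)) // size_polyX.
  rewrite (leq_trans (size_poly_exp_leq _ _)) // ltnS.
  by case: (size _) s2 => [|[|[|//]]] _; rewrite ?mul0n ?mul1n.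
rewrite -mulmxA -map_mxM mxE (leq_trans (size_sum _ _ _)) //.
apply/bigmax_leqP => j _; rewrite !mxE mulrC mul_polyC (leq_trans (size_scale_leq _ _)) //.
rewrite (leq_trans (size_polyMleq _ _)) //.
have := lin x0 (x1 - x0) (e - j)%N; have := lin y0 (y1 - y0) j.
by have := leq_ord j; lia.
Qed.

Lemma line_arc_chart M k : k != 0 -> forms A x0 y0 = k *: minors E ->
  chart_arc E C B D M line_arc.
Proof.
move=> k0 start.
have chart0H t : (chart0 B^pC line_arc).[t] =
    chart0 B (forms A (x0 + (x1 - x0) * t) (y0 + (y1 - y0) * t)).
  by rewrite -horner_evalE -map_chart0 horner_polyC_mx horner_line_arc.
have chartYH t : map_mx (horner_eval t) (chartY B^pC D^pC line_arc) =
    chartY B D (forms A (x0 + (x1 - x0) * t) (y0 + (y1 - y0) * t)).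
  by rewrite -map_chartY !horner_polyC_mx horner_line_arc.
split=> [|i j|j].
- by rewrite chart0H !mulr0 !addr0 start chart0Z (chart0_frame F) mulr1.
- rewrite (_ : (_ : {poly K}).[0] = map_mx (horner_eval 0) (chartY B^pC D^pC line_arc) i j).
    by rewrite chartYH !mulr0 !addr0 start chartYZ (chartY_frame F) scaler0 mxE.
  by rewrite [RHS]mxE.
rewrite (_ : _ - _ = 0) ?dvdp0 //; apply/eqP; rewrite subr_eq0; apply/eqP.
apply: poly_funext => t; rewrite !hornerM horner_exp chart0H.
have entry (w : 'rV[{poly K}]_N) : (w 0 j).[t] = map_mx (horner_eval t) w 0 j.
  by rewrite mxE.
rewrite !entry horner_line_arc map_minors map_mxD map_mxZ map_mxM !horner_polyC_mx chartYH.
rewrite /= horner_evalE chart0H.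
have [k' [A' ->]] := A_cone (x0 + (x1 - x0) * t) (y0 + (y1 - y0) * t).
have /rowP /(_ j) := minors_chart F A' k'.
by rewrite mxE [RHS]mxE.
Qed.

End Arc.

Lemma forms_cone e (A : 'M[K]_(e.+1, N)) :
  P1_image A `<=` grassmannian K n r ->
  forall x y, exists k M, forms A x y = k *: @minors n r K M.
Proof.
move=> AG; have cone x y : (x, y) != (0, 0) ->
    exists k M, forms A x y = k *: @minors n r K M.
  by move=> xy0; apply/grassmannian_minors/AG; exists x, y.
move=> x y; have [[-> ->]|] := eqVneq (x, y) (0, 0); last exact: cone.
case: e A cone {AG} => [|e] A cone.
  rewrite (_ : forms A 0 0 = forms A 1 0).
    by apply: cone; apply/eqP => -[/eqP]; rewrite oner_eq0.
  by rewrite /forms !big_ord1 !expr0.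
exists 0, 0; rewrite scale0r formsE (_ : monomials _ _ _ = 0) ?mul0mx //.
apply/rowP => j; rewrite !mxE !expr0n; have := leq_ord j.
by case: (nat_of_ord j) => [|i] _ /=; rewrite ?mulr0 ?mul0r.
Qed.

(** The form dual to [mixed_basis k E C] vanishes to order [k] at the origin of a
    rational curve on the Grassmannian, so it vanishes on the whole curve when
    the degree is less than [k]. *)
Lemma curve_mixed_le e (A : 'M[K]_(e.+1, N)) k : (k <= q)%N -> (k <= c)%N ->
  P1_image A `<=` grassmannian K n r -> P1_image A <[minors E]>%VS ->
  P1_image A <[minors (mixed_basis k E C)]>%VS -> (k <= e)%N.
Proof.
move=> kq kc AG [x0 [y0 [_ pE]]] [x1 [y1 [_ qE]]].
rewrite leqNgt; apply/negP => ek.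
have /vlineP [a0 start] : forms A x0 y0 \in <[minors E]>%VS by rewrite pE memv_line.
have /vlineP [a1 finish] : minors (mixed_basis k E C) \in <[forms A x1 y1]>%VS.
  by rewrite -qE memv_line.
have a00 : a0 != 0.
  apply: contraNneq (minors_neq0 (frame_EB F)) => a00.
  by have := memv_line (minors E); rewrite pE start a00 scale0r memv0.
have arc := line_arc_chart x1 y1 (forms_cone AG) e.+1 a00 start.
have /dvdXnP h0 := arc_mixed_dual F arc ek kq.
set h := coform (mixed_dual k B D) in h0.
have {}h0 : (line_arc A x0 y0 x1 y1 *m h^pC) 0 0 = 0.
  apply/polyP => i; rewrite coef0; have [/h0 //|ei] := ltnP i e.+1.
  by rewrite nth_default // (leq_trans (size_line_arc _ _ _ _ _ _)).
have := minors_coform (mixed_basis k E C) (mixed_dual k B D).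
rewrite (mixed_basisK F) // det1 finish -scalemxAl mxE -/h.
have -> : (forms A x1 y1 *m h) 0 0 = ((line_arc A x0 y0 x1 y1 *m h^pC) 0 0).[1].
  rewrite (_ : (_ : {poly K}).[1] =
    map_mx (horner_eval 1) (line_arc A x0 y0 x1 y1 *m h^pC) 0 0).
    by rewrite map_mxM horner_polyC_mx horner_line_arc !mulr1 !subrKC.
  by rewrite [RHS]mxE.
by rewrite h0 horner0 mulr0 => /esym/eqP; rewrite oner_eq0.
Qed.

Lemma minors_grassmannian (A : 'M[K]_(q, n.+1)) (A' : 'M[K]_(n.+1, q)) :
  A *m A' = 1%:M -> grassmannian K n r <[minors A]>%VS.
Proof.
move=> AA'; pose f := linfun (mulmxr A : 'rV[K]_q -> 'rV[K]_n.+1).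
have dimf : \dim (f @: fullv) = q.
  rewrite limg_dim_eq ?dimvf ?[dim _]mul1n // capfv; apply/eqP; rewrite -subv0.
  apply/subvP => u; rewrite memv_ker memv0 lfunE /= => /eqP uA.
  by rewrite -[u]mulmx1 -AA' mulmxA uA mul0mx.
exists (f @: fullv)%VS => //; apply: (pluckerE dimf AA') => i.
by rewrite rowE (_ : _ *m A = f (delta_mx 0 i)) ?memv_img ?memvf // lfunE.
Qed.

Section MixedCurve.
Variable k : nat.
Hypotheses (kq : (k <= q)%N) (kc : (k <= c)%N).
Let Fk : 'M[K]_(q, n.+1) := pid_mx k *m C.

Let Fk0 (i : 'I_q) j : (k <= i)%N -> Fk i j = 0.
Proof. by move=> ki; rewrite mxE big1 // => l _; rewrite mxE (ltnNge i) ki andbF mul0r. Qed.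

(** The last [q - k] rows of [x *: E + y *: Fk] are divisible by [x]; dividing them
    by [x] leaves a matrix whose first [k] rows are linear forms in [x] and [y] and
    whose other rows are constant. The values of these forms of degree [k] are its
    Pluecker vectors, which join [E] to [mixed_basis k E C]. *)
Definition mixed_curve : 'M[K]_(k.+1, N) := \matrix_(j < k.+1) mixminors j E Fk.

Lemma forms_mixed_curve x y :
  x ^+ (q - k) *: forms mixed_curve x y = minors (x *: E + y *: Fk).
Proof.
pose f j := x ^+ (q - k) *: ((x ^+ (k - j) * y ^+ j) *: mixminors j E Fk).
transitivity (\sum_(j < k.+1) f j).
  by rewrite scaler_sumr; apply: eq_bigr => j _; rewrite rowK.
rewrite minors_pencil (big_ord_widen q.+1 f) //.
rewrite [RHS](bigID (fun j : 'I_q.+1 => (j < k.+1)%N)) /=.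
rewrite [X in _ = _ + X]big1 ?addr0 => [|j]; last first.
  by rewrite -leqNgt => kj; rewrite (mixminors_gt _ kq Fk0 kj) scaler0.
apply: eq_bigr => j jk; rewrite /f scalerA mulrA -exprD.
by congr ((x ^+ _ * _) *: _); move: jk kq; lia.
Qed.

Lemma forms_mixed_curve0 y : forms mixed_curve 0 y = y ^+ k *: minors (mixed_basis k E C).
Proof.
rewrite /forms big_ord_recr /= big1 ?add0r => [|j _].
  by rewrite rowK subnn mul1r -mixed_minors.
rewrite expr0n (_ : (k - j == 0)%N = false) ?mul0r ?scale0r //.
by have := ltn_ord j; lia.
Qed.

Definition mixed_curve_dual : 'M[K]_(N, k.+1) :=
  \matrix_(i < N, j < k.+1) coform (mixed_dual j B D) i 0.

(** The form dual to [mixed_basis j E C] takes the value [x ^+ (k - j) * y ^+ j], so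
    it picks the coefficient [j] of the curve. *)
Lemma mixed_curveK : mixed_curve *m mixed_curve_dual = 1%:M.
Proof.
apply/matrixP => i j.
have jk := leq_ord j; have jq := leq_trans jk kq; have jc := leq_trans jk kc.
pose P : {poly K} := \poly_(l < q.+1) (mixminors l E Fk *m coform (mixed_dual j B D)) 0 0.
have PX : P = 'X^j.
  apply: poly_funext => y; rewrite horner_poly hornerXn.
  transitivity (\det ((1 *: E + y *: Fk) *m mixed_dual j B D)).
    rewrite -minors_coform minors_pencil mulmx_suml summxE; apply: eq_bigr => l _.
    by rewrite -scalemxAl [RHS]mxE expr1n mul1r mulrC.
  rewrite scale1r mulmxDl (frame_E_dual j F) -scalemxAl -mulmxA (frame_C_dual j F).
  rewrite mul_pid_mx (minn_idPr jk) (minn_idPr jc).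
  rewrite (_ : _ + _ = diag_mx (\row_a (if (a < j)%N then y else 1))).
    rewrite det_diag (eq_bigr (fun a : 'I_q => if (a < j)%N then y else 1)) => [|a _];
      last by rewrite mxE.
    by rewrite -big_mkcond /= (big_ord_narrow jq) prodr_const card_ord.
  apply/matrixP => a b; rewrite !mxE -[(a == b :> nat)]/(a == b).
  have [->|_] := eqVneq a b; last by rewrite /= mulr0 subrr addr0.
  by case: ifP => _ /=; rewrite ?mulr1 ?mulr0 ?subrr ?subr0 ?add0r ?addr0.
transitivity (P`_i); last by rewrite PX coefXn !mxE.
rewrite coef_poly (leq_trans (ltn_ord i)) ?ltnS // !mxE.
by apply: eq_bigr => l _; rewrite !mxE.
Qed.

Lemma mixed_curve_grassmannian : P1_image mixed_curve `<=` grassmannian K n r.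
Proof.
move=> _ [x [y [xy0 ->]]]; have [x0|x0] := eqVneq x 0.
  have y0 : y != 0 by apply: contraNneq xy0 => ->; rewrite x0.
  rewrite x0 forms_mixed_curve0 vlineZ ?expf_neq0 //.
  exact: minors_grassmannian (mixed_basisK F kq kc).
rewrite -(vlineZ _ (expf_neq0 (q - k) x0)) forms_mixed_curve.
apply: (minors_grassmannian (A' := x^-1 *: B)).
rewrite mulmxDl -!scalemxAl -!scalemxAr (frame_EB F) -mulmxA (frame_CB F).
by rewrite mulmx0 !scaler0 addr0 scalerA mulfV // scale1r.
Qed.

Lemma mixed_curve_source : P1_image mixed_curve <[minors E]>%VS.
Proof.
exists 1, 0; split; first by apply/eqP => -[/eqP]; rewrite oner_eq0.
by have := forms_mixed_curve 1 0; rewrite expr1n !scale1r scale0r addr0 => ->.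
Qed.

Lemma mixed_curve_target : P1_image mixed_curve <[minors (mixed_basis k E C)]>%VS.
Proof.
exists 0, 1; split; first by apply/eqP => -[/eqP]; rewrite oner_eq0.
by rewrite forms_mixed_curve0 expr1n scale1r.
Qed.

End MixedCurve.

End CurvesOnGrassmannian.

(** * The three descriptions agree *)

Theorem lemma6p5 (R : realType) (n r : nat) (hrn : (r < n)%N)
    (p : {vspace 'rV[Cplx R]_('C(n.+1, r.+1))})
    (V : nat -> {vspace 'rV[Cplx R]_n.+1})
    (hV : complete_flag V) (hp : plucker r (V r.+1) = p)
    (l : 'cV[Cplx R]_('C(n.+1, r.+1)))
    (U : set 'rV[Cplx R]_(r.+1 * (n - r)))
    (phi : 'rV[Cplx R]_(r.+1 * (n - r)) -> 'rV[Cplx R]_('C(n.+1, r.+1)))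
    (hphi : local_parametrization (grassmannian (Cplx R) n r) p l U phi)
    (m : nat) (hm : (1 <= m <= r.+1)%N) :
  R_osc phi m = R_schubert r V m /\ R_schubert r V m = R_curves p m.
Proof.
have [m1 mr] := andP hm.
have dV : \dim (V r.+1) = r.+1 by have [dimV _] := hV; apply: dimV; exact: leq_trans hrn.
have frameW W : \dim W = r.+1 -> exists k E C B D,
    [/\ (k <= r.+1)%N, (k <= n - r)%N, @frame n r (Cplx R) E C B D,
      p = <[minors E]>%VS & plucker r W = <[minors (mixed_basis k E C)]>%VS /\
      (r.+1 - m <= \dim (W :&: V r.+1))%N = (k <= m)%N].
  move=> dW; have [k [E [C [B [D [kr kc dWV F [EV WU]]]]]]] := adapted_frame hrn dW dV.
  exists k, E, C, B, D; split; [exact: kr | exact: kc | exact: F | |].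
    by rewrite -hp; exact: pluckerE dV (frame_EB F) EV.
  split; first exact: pluckerE dW (mixed_basisK F kr kc) WU.
  by rewrite dWV; apply/idP/idP; move: kr mr; lia.
split; apply/seteqP; split=> L.
- move=> [[W dW <-]]; have [k [E [C [B [D [kr kc F pE [WE WV]]]]]]] := frameW W dW.
  rewrite WE => /(osculating_mixed hphi F pE kr kc m1) km.
  by exists W; [split; [exact: dW | rewrite WV] | exact: WE].
- move=> [W [dW]]; have [k [E [C [B [D [kr kc F pE [WE WV]]]]]]] := frameW W dW.
  rewrite WV => km <-; split; first by exists W.
  by rewrite WE; apply/(osculating_mixed hphi F pE kr kc m1).
- move=> [W [dW]]; have [k [E [C [B [D [kr kc F pE [WE WV]]]]]]] := frameW W dW.
  rewrite WV => km <-.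
  (* when the point is p itself, any line through it will do *)
  pose d := maxn k 1.
  have d0 : (0 < d)%N by rewrite leq_max orbT.
  have dr : (d <= r.+1)%N by rewrite geq_max kr.
  have dc : (d <= n - r)%N by rewrite geq_max kc subn_gt0.
  have dm : (d <= m)%N by rewrite geq_max km.
  exists (P1_image (mixed_curve E C d)).
    split; last exact: (mixed_curve_grassmannian F dr dc).
      exact: (ex_intro2 _ _ d dm (rational_normal_forms d0 (mixed_curveK F dr dc))).
    by rewrite pE; exact: (mixed_curve_source E C dr dc).
  rewrite WE; have [k0|k0] := posnP k.
    have -> : minors (mixed_basis k E C) = minors E.
      by rewrite mixed_minors ?k0 ?mixminors0.
    exact: (mixed_curve_source E C dr dc).
  have -> : d = k by apply/maxn_idPl.
  exact: (mixed_curve_target E C kr kc).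
move=> [X [[d dm [[e [A [embA ->]]] degA _]] Ap AG] AL].
have [W dW WL] := AG L AL; exists W; last exact: WL.
have [k [E [C [B [D [kr kc F pE [WE WV]]]]]]] := frameW W dW.
split; [exact: dW | rewrite WV; apply: leq_trans dm].
apply: leq_trans (curve_degree_ge embA degA).
by apply: (curve_mixed_le F kr kc AG); rewrite -?pE // -WE WL.
Qed.
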